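(* Let $d\ge 1$ and $m\in\{0,1\}$ be integers and let $\alpha\in[2_*,2^* )$. For any $\omega\in(0,\infty)$ we have $\gamma_\omega=\beta_\omega$.
   Context: $\mathbb{T}=\mathbb{R}/2\pi\mathbb{Z}$; points of $\mathbb{R}^d\times\mathbb{T}^m$ are written $(x,y)$ with $x\in\mathbb{R}^d$, $y\in\mathbb{T}^m$ (for $m=0$ the variable $y$ and all $y$-derivatives are absent). $2_*=4/d$; $2^*=\infty$ if $d+m\le 2$ and $2^*=\frac{4}{d+m-2}$ if $d+m\ge 3$. $\|\cdot\|_p$ is the norm of $L^p(\mathbb{R}^d\times\mathbb{T}^m)$; functions are complex-valued. For $u\in H^1(\mathbb{R}^d\times\mathbb{T}^m)$ put $$M(u)=\|u\|_2^2,\quad E(u)=\tfrac12\|\nabla_{x,y}u\|_2^2-\tfrac1{\alpha+2}\|u\|_{\alpha+2}^{\alpha+2},\quad S_\omega(u)=E(u)+\tfrac{\omega}{2}M(u),$$ $$K(u)=\|\nabla_x u\|_2^2-\tfrac{\alpha d}{2(\alpha+2)}\|u\|_{\alpha+2}^{\alpha+2},\quad N_\omega(u)=\omega M(u)+\|\nabla_{x,y}u\|_2^2-\|u\|_{\alpha+2}^{\alpha+2}.$$ Define $$\gamma_\omega=\inf\{S_\omega(u):u\in H^1(\mathbb{R}^d\times\mathbb{T}^m)\setminus\{0\},\,K(u)=0\},\quad \beta_\omega=\inf\{S_\omega(u):u\in H^1(\mathbb{R}^d\times\mathbb{T}^m)\setminus\{0\},\,N_\omega(u)=0\}.$$ 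*)

(* Defs.v *)
From HB Require Import structures.
From mathcomp Require Import all_boot all_order all_algebra.
From mathcomp Require Import all_classical all_reals all_analysis.
From mathcomp Require Import complex.

Set Implicit Arguments.
Unset Strict Implicit.
Unset Printing Implicit Defensive.

Import Order.TTheory GRing.Theory Num.Theory.
Import numFieldNormedType.Exports.

Local Open Scope classical_set_scope.
Local Open Scope ring_scope.

Definition measure_rV_display : measure_display.
Proof. exact: default_measure_display. Qed.

(* The sigma-algebra on R^n generated by the coordinates, i.e. the Borel one. *)
Section measurable_rV.
Variables (R : realType) (n : nat).

Let coords (i : 'I_n) (x : 'rV[R]_n) : R := x ord0 i.

Let rV_set0 : g_sigma_preimage coords set0.
Proof. exact: sigma_algebra0. Qed.

Let rV_setC A : g_sigma_preimage coords A -> g_sigma_preimage coords (~` A).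
Proof. exact: sigma_algebraC. Qed.

Let rV_bigcup (F : (set 'rV[R]_n)^nat) :
  (forall i, g_sigma_preimage coords (F i)) ->
  g_sigma_preimage coords (\bigcup_i (F i)).
Proof. exact: sigma_algebra_bigcup. Qed.

HB.instance Definition _ := @isMeasurable.Build measure_rV_display
  'rV[R]_n (g_sigma_preimage coords) rV_set0 rV_setC rV_bigcup.

End measurable_rV.

Section measurable_fun_rV.
Context {R : realType}.

Lemma measurable_coord n (i : 'I_n) :
  measurable_fun [set: 'rV[R]_n] (fun x : 'rV[R]_n => x ord0 i).
Proof.
move=> _ Y mY; rewrite setTI; apply: sub_sigma_algebra => /=.
rewrite -bigcup_seq/=; exists i => /=; first by rewrite mem_index_enum.
by exists Y => //; rewrite setTI.
Qed.

Lemma measurable_fun_rV {d} {T : measurableType d} n (f : T -> 'rV[R]_n) :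
  (forall i, measurable_fun [set: T] (fun x => f x ord0 i)) ->
  measurable_fun [set: T] f.
Proof.
move=> mf.
apply: (@iffRL _ (g_sigma_preimage (fun i x => f x ord0 i) `<=` measurable)).
  rewrite (@g_sigma_preimage_comp _ R n _ (fun i (x : 'rV[R]_n) => x ord0 i) _ f).
  by split=> [h A [/= C preC <-]|h _ A mA]; [exact: h|apply: h; exists A].
apply: smallest_sub; first exact: sigma_algebra_measurable.
rewrite -bigcup_seq; apply: bigcup_sub => i _ A [B mB <-].
exact: mf.
Qed.

(* R x R^n = R^(n+1); the codomain is convertible to 'rV[R]_(1 + n). *)
Definition cons_rV n (z : measurableTypeR R * 'rV[R]_n) : 'rV[R]_n.+1 :=
  row_mx (const_mx z.1 : 'rV_1) z.2.

Definition uncons_rV n (x : 'rV[R]_n.+1) : measurableTypeR R * 'rV[R]_n :=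
  (x ord0 ord0, \row_j x ord0 (lift ord0 j)).

Lemma cons_rVK n : cancel (@cons_rV n) (@uncons_rV n).
Proof.
move=> [a v]; rewrite /uncons_rV /cons_rV/=; congr pair.
  by rewrite mxE; case: split_ordP => // k _; rewrite mxE.
apply/rowP => j; rewrite !mxE; case: split_ordP => k.
  by move=> /(congr1 val)/=; rewrite ord1.
by move=> /(congr1 val)/= [/val_inj ->].
Qed.

Lemma measurable_cons_rV n :
  measurable_fun [set: measurableTypeR R * 'rV[R]_n] (@cons_rV n).
Proof.
apply: measurable_fun_rV => i; rewrite /cons_rV.
have [i0|i0] := ltnP i 1.
  rewrite (_ : (fun _ => _) = (fst : measurableTypeR R * 'rV[R]_n -> _)).
    exact: measurable_fst.
  apply/funext => z; rewrite (_ : i = lshift n (ord0 : 'I_1)).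
    by apply: (etrans (@row_mxEl R 1 1 n _ _ _ _)); rewrite mxE.
  by apply/val_inj => /=; case: (val i) i0.
have j_lt : (i.-1 < n)%N by rewrite prednK// -ltnS.
pose j := Ordinal j_lt.
rewrite (_ : (fun _ => _) = (fun x : 'rV[R]_n => x ord0 j) \o snd).
  by apply: measurableT_comp; [exact: measurable_coord|exact: measurable_snd].
apply/funext => z/=; rewrite (_ : i = rshift 1 j :> 'I_(1 + n)).
  exact: (@row_mxEr R 1 1 n).
by apply/val_inj; rewrite /= [RHS]add1n prednK.
Qed.

HB.instance Definition _ n :=
  @isMeasurableFun.Build _ _ _ _ (@cons_rV n) (@measurable_cons_rV n).

Lemma measurable_uncons_rV n : measurable_fun [set: 'rV[R]_n.+1] (@uncons_rV n).
Proof.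
apply/measurable_fun_pairP; split => /=; first exact: measurable_coord.
apply: measurable_fun_rV => i.
rewrite (_ : (fun _ => _) = (fun x : 'rV[R]_n.+1 => x ord0 (lift ord0 i))).
  exact: measurable_coord.
by apply/funext => x /=; rewrite mxE.
Qed.

End measurable_fun_rV.

(* Restated because the library's instance of this fact for \x is shadowed by
   the one for subprobabilities. *)
Lemma sigma_finite_prod d1 d2 (T1 : measurableType d1) (T2 : measurableType d2)
    (R : realType) (m1 : {sigma_finite_measure set T1 -> \bar R})
    (m2 : {sigma_finite_measure set T2 -> \bar R}) :
  sigma_finite setT (m1 \x m2)%E.
Proof.
have /sigma_finiteP[F [TF ndF Foo]] := sigma_finiteT m1.
have /sigma_finiteP[G [TG ndG Goo]] := sigma_finiteT m2.
exists (fun n => F n `*` G n).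
  rewrite -setXTT TF TG predeqE => -[x y]; split.
    move=> [/= [n _ Fnx] [k _ Gky]]; exists (maxn n k) => //; split.
    - by move: x Fnx; exact/subsetPset/ndF/leq_maxl.
    - by move: y Gky; exact/subsetPset/ndG/leq_maxr.
  by move=> [n _ []/= ? ?]; split; exists n.
move=> k; have [? ?] := Foo k; have [? ?] := Goo k.
split; first exact: measurableX.
by rewrite product_measure1E// lte_mul_pinfty// ge0_fin_numE.
Qed.

Section cons_measure.
Context {R : realType} (n : nat).
Variables (nu : {sigma_finite_measure set (measurableTypeR R) -> \bar R})
          (mu : {sigma_finite_measure set 'rV[R]_n -> \bar R}).

Definition cons_measure : set 'rV[R]_n.+1 -> \bar R :=
  pushforward (nu \x mu)%E (@cons_rV R n).

Let cons_measure0 : cons_measure set0 = 0%E.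
Proof. exact: measure0. Qed.

Let cons_measure_ge0 A : (0 <= cons_measure A)%E.
Proof. exact: measure_ge0. Qed.

Let cons_measure_sigma_additive : semi_sigma_additive cons_measure.
Proof. exact: measure_semi_sigma_additive. Qed.

HB.instance Definition _ := isMeasure.Build _ _ _ cons_measure
  cons_measure0 cons_measure_ge0 cons_measure_sigma_additive.

Let cons_measure_sigma_finite : sigma_finite setT cons_measure.
Proof.
have [F FT mF] : sigma_finite setT (nu \x mu)%E by exact: sigma_finite_prod.
exists (fun k => @uncons_rV R n @^-1` F k) => [|k].
  by rewrite -preimage_bigcup -FT preimage_setT.
have [mFk Fk_lty] := mF k; split.
  by rewrite -[X in measurable X]setTI; exact: measurable_uncons_rV.
rewrite /cons_measure /pushforward -comp_preimage.
by rewrite (_ : _ \o _ = id) ?preimage_id//; apply/funext/cons_rVK.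
Qed.

HB.instance Definition _ := Measure_isSigmaFinite.Build _ _ _ cons_measure
  cons_measure_sigma_finite.
End cons_measure.

(* The n-fold product of nu with itself; R^0 is a point, with unit mass. *)
Section power_measure.
Context {R : realType}.
Variable nu : {sigma_finite_measure set (measurableTypeR R) -> \bar R}.

Fixpoint power_measure n : {sigma_finite_measure set 'rV[R]_n -> \bar R} :=
  match n with
  | 0 => \d_(0 : 'rV[R]_0)
  | n.+1 => cons_measure nu (power_measure n)
  end.
End power_measure.

(* Lebesgue measure on a fundamental domain of T = R / 2 pi Z. *)
Section circle_measure.
Context {R : realType}.

Let measurable_cell : measurable (`[0, 2 * pi[%classic : set (measurableTypeR R)).
Proof. exact: measurable_itv. Qed.

Definition circle_measure : set (measurableTypeR R) -> \bar R :=
  mrestr lebesgue_measure measurable_cell.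

HB.instance Definition _ := Measure.on circle_measure.

Let circle_measure_finite : fin_num_fun circle_measure.
Proof.
apply: lty_fin_num_fun; rewrite /= /circle_measure /mrestr setTI.
by rewrite /= lebesgue_measure_itv/=; case: ifP; rewrite ?ltry// -EFinB ltry.
Qed.

HB.instance Definition _ :=
  Measure_isFinite.Build _ _ _ circle_measure circle_measure_finite.
End circle_measure.

Section smooth.
Context {R : realType} {V : normedModType R}.

(* V is finite-dimensional below, so that differentiating along every vector
   amounts to taking all the partial derivatives. *)
Fixpoint Cn (n : nat) (f : V -> R^o) : Prop :=
  match n with
  | 0 => continuous f
  | n.+1 => continuous f /\
      forall v, (forall z, derivable f z v) /\ Cn n (fun z => 'D_v f z)
  end.

Definition smooth (f : V -> R^o) := forall n, Cn n f.
End smooth.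

(* Functions on R^d x T^m are functions of (x, y) in R^d x R^m which are
   2 pi-periodic in each coordinate of y; they are integrated over
   R^d x [0, 2 pi[^m. *)
Section cylinder.
Context {R : realType} {d m : nat}.

Local Notation X := ('rV[R]_d * 'rV[R]_m)%type.
Local Notation C := R[i].

Definition y_periodic (T : Type) (u : X -> T) := forall x y (j : 'I_m),
  u (x, y + (2 * pi) *: delta_mx ord0 j) = u (x, y).

Definition cyl_measure : set X -> \bar R :=
  (power_measure lebesgue_measure d \x power_measure circle_measure m)%E.

HB.instance Definition _ := Measure.on cyl_measure.

HB.instance Definition _ := Measure_isSigmaFinite.Build _ _ _ cyl_measure
  (sigma_finite_prod (power_measure lebesgue_measure d)
                     (power_measure circle_measure m)).

Definition cintegral (f : X -> C) : C :=
  Complex (\int[cyl_measure]_z complex.Re (f z))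
          (\int[cyl_measure]_z complex.Im (f z)).

(* norm_ p u is the L^p norm whenever u is in L^p; this covers u in H^1 with p = 2,
   and p = alpha + 2 in the Sobolev range used here. *)
Definition enorm_ (p : R) (u : X -> C) : \bar R :=
  ('N[cyl_measure]_(p%:E)[EFin \o (@Normc.normc R \o u)])%E.

Definition norm_ (p : R) (u : X -> C) : R := fine (enorm_ p u).

Definition L2 (u : X -> C) : Prop :=
  [/\ y_periodic u,
      measurable_fun [set: X] (fun z => complex.Re (u z)),
      measurable_fun [set: X] (fun z => complex.Im (u z)) &
      (enorm_ 2 u < +oo)%E].

Definition test_function (phi : X -> R) : Prop :=
  [/\ smooth phi, y_periodic phi &
      exists r : R, forall x y, r < `|x| -> phi (x, y) = 0].

Definition is_weak_derivative (e : X) (u v : X -> C) : Prop :=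
  forall phi, test_function phi ->
    cintegral (fun z => u z * ('D_e (phi : X -> R^o) z)%:C%C) =
    - cintegral (fun z => v z * (phi z)%:C%C).

Definition dir_x (i : 'I_d) : X := (delta_mx ord0 i, 0).
Definition dir_y (j : 'I_m) : X := (0, delta_mx ord0 j).

Definition L2_derivatives (e : X) (u : X -> C) : set (X -> C) :=
  [set v | L2 v /\ is_weak_derivative e u v].

Definition H1 (u : X -> C) : Prop :=
  [/\ L2 u, (forall i, L2_derivatives (dir_x i) u !=set0) &
            (forall j, L2_derivatives (dir_y j) u !=set0)].

(* For u in H^1 this is determined up to a null set. *)
Definition weak_derivative (e : X) (u : X -> C) : X -> C :=
  xget (fun=> 0) (L2_derivatives e u).

Definition grad_x_sqnorm (u : X -> C) : R :=
  \sum_(i < d) norm_ 2 (weak_derivative (dir_x i) u) ^+ 2.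

Definition grad_y_sqnorm (u : X -> C) : R :=
  \sum_(j < m) norm_ 2 (weak_derivative (dir_y j) u) ^+ 2.

Definition grad_sqnorm (u : X -> C) : R := grad_x_sqnorm u + grad_y_sqnorm u.

Variables alpha omega : R.

Definition mass (u : X -> C) : R := norm_ 2 u ^+ 2.

Definition potential (u : X -> C) : R := norm_ (alpha + 2) u `^ (alpha + 2).

Definition energy (u : X -> C) : R :=
  2^-1 * grad_sqnorm u - (alpha + 2)^-1 * potential u.

Definition action (u : X -> C) : R := energy u + omega / 2 * mass u.

Definition virial (u : X -> C) : R :=
  grad_x_sqnorm u - alpha * d%:R / (2 * (alpha + 2)) * potential u.

Definition nehari (u : X -> C) : R :=
  omega * mass u + grad_sqnorm u - potential u.

Definition H1_nonzero : set (X -> C) :=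
  [set u | H1 u /\ ~ {ae cyl_measure, forall z, u z = 0}].

Definition gamma_inf : \bar R :=
  ereal_inf [set (action u)%:E | u in H1_nonzero `&` [set u | virial u = 0]].

Definition beta_inf : \bar R :=
  ereal_inf [set (action u)%:E | u in H1_nonzero `&` [set u | nehari u = 0]].

End cylinder.

Arguments gamma_inf {R} d m alpha omega.
Arguments beta_inf {R} d m alpha omega.

Definition lower_critical (R : realType) (d : nat) : R := 4 / d%:R.

Definition upper_critical (R : realType) (d m : nat) : \bar R :=
  if (d + m <= 2)%N then +oo%E else (4 / (d + m - 2)%:R)%:E.

(* Main.v *)
Require Import Defs.
From HB Require Import structures.
From mathcomp Require Import all_boot all_order all_algebra.
From mathcomp Require Import all_classical all_reals all_analysis.
From mathcomp Require Import measurable_realfun.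
From mathcomp Require Import complex ring lra.

Set Implicit Arguments.
Unset Strict Implicit.
Unset Printing Implicit Defensive.

Import Order.TTheory GRing.Theory Num.Theory.
Import numFieldNormedType.Exports.

Local Open Scope classical_set_scope.
Local Open Scope ring_scope.

(** Why the two levels agree. For u in H^1 let G be the squared norm of its
    x-gradient, A the squared norm of its y-gradient plus omega times its mass,
    and P its potential. The action is (G + A) / 2 - P / (alpha + 2), the Nehari
    constraint reads G + A = P, and the virial constraint reads G = c P with
    c = alpha d / (2 (alpha + 2)). The rescaling v(x, y) = s u(b x, y) turns
    (G, A, P) into s^2 b^(-d) (b^2 G, A, s^alpha P). Since 0 < c < 1, which is
    subcriticality of alpha in the variable x alone, s and b can be chosen so
    that v satisfies both constraints at once. If u satisfies one of them, the
    action of v is at most that of u: either constraint makes u a point of a curve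
    of rescalings on which the action is smallest at v, and after taking
    logarithms this is the concavity of ln with weight c (Nehari) or
    d / 2 - 2 / alpha (virial); the latter is a weight because alpha >= 4 / d.
    See [rescaling_parameters] and [critical_level_le]. Hence each competitor of
    either problem can be traded for a common competitor with no larger action
    ([exists_doubly_constrained]), and the infima coincide. That P > 0 follows from
    the constraint itself.

    Two analytic facts feed this argument.
    - The gradient norms behave as claimed under rescaling. A rescaled weak
      derivative is a weak derivative of the rescaled function
      ([rescale_derivative]), and the norm of a weak derivative does not depend on
      which one is picked, because weak derivatives are unique almost everywhere
      ([weak_derivative_unique]). Uniqueness is the fundamental lemma of the
      calculus of variations, [orthogonal_box_bump_eq0]: explicit smooth functions
      of product form converge to the indicators of boxes, and boxes determine
      measures.
    - G > 0 unless u vanishes ([grad_x_sqnorm_gt0]). If the weak derivative of u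
      along an x-axis is zero, the integral of u against a bump does not change
      when the bump is moved along that axis ([test_derivative_slide]); as the bump
      escapes to infinity the integral tends to 0 because u is square integrable
      ([constant_axis_eq0]). *)

(** * Calculus of the smoothness classes Cn *)

Section directional_calculus.
Context {R : realType} {V : normedModType R}.
Implicit Types (f g : V -> R^o) (h : R^o -> R^o).

(** The chain rule along one direction: only derivability of f along v is at
    hand, so the one-variable rule is applied on the line through z. *)
Lemma is_derive_comp h (h' : R) f (l : R) (z v : V) :
  is_derive (f z : R^o) (1 : R^o) h h' -> is_derive z v f l ->
  is_derive z v (fun w => h (f w)) (h' * l).
Proof.
move=> dh [df fl].
pose p (t : R) : R := f (t *: v + z).
(* Difference quotients along v are those of the restriction to a line. *)
have line (k : V -> R^o) :
    (fun t : R => t^-1 *: (((fun t => k (t *: v + z)) \o shift 0) (t *: (1 : R)) -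
                           k (0 *: v + z))) =
    (fun t => t^-1 *: ((k \o shift z) (t *: v) - k z)).
  by apply/funext => t /=; rewrite addr0 scale0r add0r [_%:A]mulr1.
have dp : is_derive (0 : R) (1 : R) p l.
  apply: DeriveDef; first exact: (iffLR (derivable1P f z v) df).
  by rewrite -fl /derive -(line f).
have p0 : p 0 = f z by rewrite /p scale0r add0r.
rewrite -p0 in dh.
have [dc cE] := @is_derive1_comp R h p 0 h' l dh dp.
apply: DeriveDef; first exact: (iffRL (derivable1P (h \o f) z v) dc).
by rewrite -cE /derive -(line (h \o f)).
Qed.

Lemma CnS n f (df : V -> V -> R^o) : continuous f ->
  (forall v z, is_derive z v f (df v z)) -> (forall v, Cn n (df v)) ->
  Cn n.+1 f.
Proof.
move=> fc fd dfn; split=> // v; split=> [z|]; first by have [] := fd v z.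
rewrite (_ : (fun z => _) = df v) //.
by apply/funext => z; have [_ ->] := fd v z.
Qed.

Lemma Cn_continuous n f : Cn n f -> continuous f.
Proof. by case: n => [//|n []]. Qed.

Lemma Cn_derive n f v : Cn n.+1 f -> Cn n (fun z => 'D_v f z).
Proof. by move=> [_ /(_ v)[]]. Qed.

Lemma Cn_is_derive n f v z : Cn n.+1 f -> is_derive z v f ('D_v f z).
Proof. by move=> [_ /(_ v)[+ _]] => /(_ z) /derivableP. Qed.

Lemma Cn_pred n f : Cn n.+1 f -> Cn n f.
Proof.
elim: n f => [f []//|n ih f fn].
split; first exact: Cn_continuous fn.
move=> v; split=> [z|]; first by have [] := Cn_is_derive v z fn.
exact/ih/Cn_derive.
Qed.

Lemma Cn_cst n (c : R) : Cn n (fun _ : V => c : R^o).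
Proof.
elim: n c => [|n ih] c; first by move=> z; exact: cvg_cst.
apply: (@CnS _ _ (fun _ _ => 0)) => [z|v].
- exact: cvg_cst.
- exact: ih.
Qed.

Lemma Cn_add n f g : Cn n f -> Cn n g -> Cn n (fun z => f z + g z).
Proof.
elim: n f g => [|n ih] f g fn gn; first by move=> z; apply: cvgD; [exact: fn|exact: gn].
apply: (@CnS _ _ (fun v z => 'D_v f z + 'D_v g z)) => [z|v z|v].
- by apply: cvgD; [exact: (Cn_continuous fn)|exact: (Cn_continuous gn)].
- exact: (@is_deriveD _ _ _ f g z v _ _ (Cn_is_derive v z fn) (Cn_is_derive v z gn)).
- by apply: ih; exact: Cn_derive.
Qed.

Lemma Cn_mul n f g : Cn n f -> Cn n g -> Cn n (fun z => f z * g z).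
Proof.
elim: n f g => [|n ih] f g fn gn.
  by move=> z; exact: (@continuousM R V f g z (fn z) (gn z)).
apply: (@CnS _ _ (fun v z => f z * 'D_v g z + g z * 'D_v f z)) => [z|v z|v].
- have [fc gc] := (Cn_continuous fn, Cn_continuous gn).
  exact: (@continuousM R V f g z (fc z) (gc z)).
- exact: (@is_deriveM _ _ f g z v _ _ (Cn_is_derive v z fn) (Cn_is_derive v z gn)).
- by apply: Cn_add; apply: ih; solve [exact: Cn_pred|exact: Cn_derive].
Qed.

Lemma Cn_prod n (I : Type) (r : seq I) (F : I -> V -> R^o) :
  (forall i, Cn n (F i)) -> Cn n (fun z => \prod_(i <- r) F i z).
Proof.
move=> Fn; elim: r => [|i r ih].
  by under eq_fun do rewrite big_nil; exact: Cn_cst.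
by under eq_fun do rewrite big_cons; exact: Cn_mul.
Qed.

End directional_calculus.

Section composition.
Context {R : realType} {V : normedModType R}.

Lemma Cn_comp n (h : R^o -> R^o) (f : V -> R^o) : Cn n h -> Cn n f -> Cn n (fun z => h (f z)).
Proof.
elim: n h f => [|n ih] h f hn fn.
  by move=> z; apply: continuous_comp; [exact: fn|exact: hn].
apply: (@CnS _ _ _ _ (fun v z => 'D_1 h (f z) * 'D_v f z)) => [z|v z|v].
- have [fc hc] := (Cn_continuous fn, Cn_continuous hn).
  by apply: continuous_comp; [exact: fc|exact: hc].
- exact: (is_derive_comp (Cn_is_derive (1 : R^o) (f z : R^o) hn) (Cn_is_derive v z fn)).
- apply: Cn_mul; last exact: Cn_derive.
  by apply: (ih (fun t => 'D_1 h t)); [exact: Cn_derive|exact: Cn_pred].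
Qed.

End composition.

Section affine_substitution.
Context {R : realType} {V W : normedModType R}.
Variables (T L : V -> W).
Hypothesis T_affine : forall (h : R) v z, T (h *: v + z) = h *: L v + T z.

Let quotient_affine (f : W -> R^o) z v :
  (fun t : R => t^-1 *: (((f \o T) \o shift z) (t *: v) - (f \o T) z)) =
  (fun t : R => t^-1 *: ((f \o shift (T z)) (t *: L v) - f (T z))).
Proof. by apply/funext => t /=; rewrite T_affine. Qed.

(** An affine substitution T with linear part L turns derivatives along v into
    derivatives along L v, because it maps the line through z to the line
    through T z. *)
Lemma derivable_affine (f : W -> R^o) z v :
  derivable f (T z) (L v) -> derivable (f \o T) z v.
Proof. by rewrite /derivable quotient_affine. Qed.

Lemma derive_affine (f : W -> R^o) z v : 'D_v (f \o T) z = 'D_(L v) f (T z).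
Proof. by rewrite /derive quotient_affine. Qed.

Lemma Cn_affine n (f : W -> R^o) : continuous T -> Cn n f -> Cn n (f \o T).
Proof.
move=> Tc; elim: n f => [|n ih] f fn.
  by move=> z; apply: continuous_comp; [exact: Tc|exact: fn].
apply: (@CnS _ _ _ _ (fun v z => 'D_(L v) f (T z))) => [z|v z|v].
- have fc := Cn_continuous fn.
  by apply: continuous_comp; [exact: Tc|exact: fc].
- apply: DeriveDef; last exact: derive_affine.
  by apply: derivable_affine; case: (Cn_is_derive (L v) (T z) fn).
- exact: (ih (fun w => 'D_(L v) f w) (Cn_derive (L v) fn)).
Qed.

End affine_substitution.

Section one_variable.
Context {R : realType}.
Implicit Types h : R^o -> R^o.

Lemma is_derive_direction h (h' z v : R) :
  is_derive (z : R^o) (1 : R^o) h h' -> is_derive (z : R^o) (v : R^o) h (h' * v).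
Proof.
by move=> dh; exact: (@is_derive_comp _ R^o h h' id v z v dh).
Qed.

(** Directional derivatives are homogeneous in the direction even though [Cn]
    speaks of each direction separately: restricted to a line, this is the
    one-variable chain rule. *)
Lemma derive_direction (V : normedModType R) (f : V -> R^o) (z v : V) (c : R) :
  Cn 1 f -> 'D_(c *: v) f z = c * 'D_v f z.
Proof.
move=> f1; pose T (t : R^o) : V := t *: v + z.
pose L (t : R^o) : V := t *: v.
have T_affine (h : R) (t t0 : R^o) : T (h *: t + t0) = h *: L t + T t0.
  by rewrite /T /L scalerDl scalerA addrA.
have T0 : T 0 = z by rewrite /T scale0r add0r.
have L1 : L 1 = v by rewrite /L scale1r.
have d1 : is_derive (0 : R^o) (1 : R^o) (f \o T) ('D_v f z).
  apply: DeriveDef; last by rewrite (derive_affine T_affine) T0 L1.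
  by apply: (derivable_affine T_affine); rewrite T0; case: (Cn_is_derive (L 1) z f1).
have [_ dc] := is_derive_direction c d1.
by rewrite [RHS]mulrC -dc (derive_affine T_affine) T0.
Qed.

(** In one variable a single derivative controls all directions. *)
Lemma CnS1 n h h' : (forall z : R, is_derive (z : R^o) (1 : R^o) h (h' z)) ->
  Cn n h' -> Cn n.+1 h.
Proof.
move=> hd hn; apply: (@CnS _ _ _ _ (fun v z => h' z * v)) => [z|v z|v].
- by apply/differentiable_continuous/derivable1_diffP; case: (hd z).
- exact: is_derive_direction.
- by apply: Cn_mul => //; exact: Cn_cst.
Qed.

Lemma smooth_id : smooth (fun t : R^o => t).
Proof.
case=> [|n]; first by move=> z; exact: cvg_id.
by apply: (@CnS1 n id (fun=> 1)) ; exact: Cn_cst.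
Qed.

Lemma smooth_expR : smooth (fun t : R^o => expR t : R^o).
Proof.
elim=> [|n ih]; first by move=> z; exact: continuous_expR.
by apply: (@CnS1 n expR expR) => // z; exact: is_derive_expR.
Qed.

Lemma smooth_sincos n : Cn n (fun t : R^o => sin t : R^o) /\ Cn n (fun t : R^o => cos t : R^o).
Proof.
elim: n => [|n [ihs ihc]].
  by split=> z; [exact: continuous_sin|exact: continuous_cos].
split; first by apply: CnS1 ihc => z; exact: is_derive_sin.
apply: (@CnS1 n _ (fun t => - 1 * sin t)); last by apply: Cn_mul => //; exact: Cn_cst.
by move=> z; rewrite mulN1r; exact: is_derive_cos.
Qed.

End one_variable.

(** * A smooth function that is flat at 0 *)

Section flat_function.
Context {R : realType}.
Implicit Types p q : {poly R}.

(** The polynomial factor makes the family p |-> flat p stable under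
    differentiation; flat 1 is the classical function exp(-1/x) on x > 0. *)
Definition flat p (x : R^o) : R^o :=
  if 0 < (x : R) then p.[x^-1] * expR (- x^-1) else 0.

(** The rate s is arbitrary for the sake of the induction on the degree: the
    factor t absorbs half of the exponential. *)
Lemma poly_le_expR p (s : R) : 0 < s ->
  exists2 C : R, 0 <= C & forall t : R, 0 <= t -> `|p.[t]| <= C * expR (s * t).
Proof.
elim/poly_ind: p s => [|p c ih] s s0.
  by exists 0 => // t t0; rewrite horner0 normr0 mul0r.
have s20 : 0 < s / 2 by rewrite divr_gt0.
have [C C0 hC] := ih _ s20.
exists (C * (s / 2)^-1 + `|c|) => [|t t0].
  by rewrite addr_ge0// mulr_ge0// invr_ge0 ltW.
rewrite hornerMXaddC (le_trans (ler_normD _ _))// mulrDl lerD//.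
- rewrite normrM (ger0_norm t0).
  rewrite (_ : s * t = s / 2 * t + s / 2 * t); last by field.
  rewrite expRD mulrACA ler_pM//; first exact: hC.
  rewrite mulrC ler_pdivlMr// mulrC (le_trans _ (expR_ge1Dx _))//.
  by rewrite lerDr.
- by rewrite ler_peMr// -expR0 ler_expR mulr_ge0// ltW.
Qed.

(** Growth of p X^2 is beaten by exp; read at t = 1/x this is quadratic decay
    at 0, which gives the derivative there. *)
Lemma flat_le_sqr p : exists2 C : R, 0 <= C & forall x : R, `|flat p x| <= C * x ^+ 2.
Proof.
have [C C0 hC] := poly_le_expR (p * 'X^2) (@ltr01 R).
exists C => // x; rewrite /flat; case: ifPn => x0; last first.
  by rewrite normr0 mulr_ge0// sqr_ge0.
have := hC x^-1; rewrite invr_ge0 (ltW x0) => /(_ isT).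
rewrite hornerM hornerXn mul1r normrM (@ger0_norm _ (x^-1 ^+ 2)) ?sqr_ge0// => h.
rewrite normrM (ger0_norm (expR_ge0 _)).
rewrite expRN ler_pdivrMr ?expR_gt0// mulrAC -ler_pdivrMr ?exprn_gt0//.
by rewrite -exprVn.
Qed.

Lemma flat_gt0 x : (0 < flat 1 x) = (0 < (x : R)).
Proof.
rewrite /flat; case: ifPn => // x0.
by rewrite hornerC mul1r expR_gt0.
Qed.

Lemma flat_ge0 (x : R) : 0 <= flat 1 x.
Proof. by rewrite /flat; case: ifPn => // _; rewrite hornerC mul1r expR_ge0. Qed.

Lemma flat_eq0 (x : R) : (flat 1 x == 0) = (x <= 0).
Proof. by rewrite eq_le flat_ge0 andbT leNgt flat_gt0 -leNgt. Qed.

Lemma is_derive_flat p (x : R^o) :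
  is_derive x (1 : R^o) (flat p) (flat ('X^2 * (p - p^`())) x).
Proof.
have [x0|x0|x0] := ltgtP (x : R) 0.
- apply: (@near_eq_is_derive _ _ _ (fun=> 0)).
    near=> y; rewrite /flat ltNge (_ : y <= 0)//; apply: ltW.
    by near: y; exact: (lt_nbhsl x0).
  rewrite /flat ltNge (ltW x0)/=; exact: is_derive_cst.
- apply: (@near_eq_is_derive _ _ _ (fun y : R => p.[y^-1] * expR (- y^-1))).
    near=> y; rewrite /flat (_ : 0 < y)//.
    by near: y; exact: (lt_nbhsr x0).
  rewrite /flat x0.
  have xn0 : id x != 0 by rewrite gt_eqF.
  have dV := @is_deriveV R id x 1 1 xn0 (is_derive_id _ _).
  have dN := @is_deriveN _ _ _ _ _ _ _ dV.
  have dE := @is_derive1_comp R expR (fun y => - y^-1) x _ _ (is_derive_expR _) dN.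
  have dP := @is_derive1_comp R (horner p) (fun y => y^-1) x _ _ (is_derive_poly _ _) dV.
  have dM := @is_deriveM _ _ _ _ _ _ _ _ dP dE.
  have -> : (fun y : R => p.[y^-1] * expR (- y^-1)) =
      (horner p \o (fun y => y^-1)) * (expR \o (fun y => - y^-1)) by [].
  refine (is_derive_eq dM _).
  rewrite /= !hornerE /= /GRing.scale/=.
  by field; rewrite gt_eqF.
(* At 0 the difference quotient is at most C |h|. *)
- have flat0 q : flat q x = 0 by rewrite /flat x0 ltxx.
  rewrite flat0 x0.
  have [C C0 hC] := flat_le_sqr p.
  suff h : (fun h : R => h^-1 *: ((flat p \o shift (0 : R)) (h *: (1 : R)) - flat p 0))
      @ 0^' --> (0 : R^o).
    by apply: DeriveDef; [apply/cvg_ex; exists 0|exact/cvg_lim].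
  have C1 : 0 < C + 1 by rewrite ltr_wpDl.
  apply/cvgrPdist_le => e e0.
  have eC : 0 < e / (C + 1) by rewrite divr_gt0.
  near=> h.
  rewrite /= sub0r normrN addr0 -x0 flat0 subr0 [h *: _]mulr1.
  have hn0 : h != 0 by near: h; exact: nbhs_dnbhs_neq.
  rewrite normrZ normfV mulrC ler_pdivrMr ?normr_gt0//.
  rewrite (le_trans (hC h))// -[h ^+ 2]ger0_norm ?sqr_ge0// normrX expr2 mulrA ler_wpM2r//.
  have : `|h| <= e / (C + 1).
    near: h; exact: (dnbhs0_le eC).
  rewrite ler_pdivlMr// mulrC; apply: le_trans.
  by rewrite ler_wpM2r// lerDl.
Unshelve. all: by end_near. Qed.

Lemma smooth_flat p : smooth (flat p).
Proof.
move=> n; elim: n p => [|n ih] p.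
  move=> x; apply/differentiable_continuous/derivable1_diffP.
  by case: (is_derive_flat p x).
by apply: CnS1 (ih _) => z; exact: is_derive_flat.
Qed.

End flat_function.

(** * Smooth approximations of indicators on the line and the circle *)

Section smoothed_indicators.
Context {R : realType}.

(** Exponential decay turns a smooth nonnegative function into a smooth
    approximation of the indicator of its zero set. *)
Lemma cvg_expRMn (c : R) : 0 <= c ->
  expR (- (n%:R * c)) @[n --> \oo] --> ((c == 0)%:R : R).
Proof.
move=> c0; under eq_cvg do rewrite -mulrN expRM_natl.
case: eqP c0 => [->|/eqP cn0] c0 /=.
  by apply: cvg_near_cst; apply: nearW => n; rewrite oppr0 expR0 expr1n.
apply: cvg_expr; rewrite ger0_norm ?expR_ge0// -expR0 ltr_expR oppr_lt0.
by rewrite lt_def cn0.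
Qed.

Let smooth_shift (b : R) n : Cn n (fun t : R^o => t + b : R^o).
Proof. by apply: Cn_add; [exact: smooth_id|exact: Cn_cst]. Qed.

Let smooth_reflect (b : R) n : Cn n (fun t : R^o => b - t : R^o).
Proof.
under eq_fun do rewrite -mulN1r.
by apply: Cn_add; [exact: Cn_cst|apply: Cn_mul; [exact: Cn_cst|exact: smooth_id]].
Qed.

Let smooth_decay (k : nat) (f : R^o -> R^o) n : Cn n f ->
  Cn n (fun t : R^o => expR (- (k%:R * f t)) : R^o).
Proof.
move=> fn; apply: (Cn_comp (smooth_expR n)).
under eq_fun do rewrite -mulNr.
by apply: Cn_mul => //; exact: Cn_cst.
Qed.

Let decay01 (k : nat) (c : R) : 0 <= c -> 0 <= expR (- (k%:R * c)) <= 1.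
Proof. by move=> c0; rewrite expR_ge0/= -expR0 ler_expR oppr_le0 mulr_ge0. Qed.

(** The product of the two flat functions is positive exactly on ]a, b[. *)
Definition bell (a b : R) (k : nat) (t : R^o) : R^o :=
  1 - expR (- (k%:R * (flat 1 (t - a) * flat 1 (b - t)))).

Lemma smooth_bell a b k : smooth (bell a b k).
Proof.
move=> n; rewrite /bell; apply: Cn_add; first exact: Cn_cst.
under eq_fun do rewrite -mulN1r.
apply: Cn_mul; first exact: Cn_cst.
apply: smooth_decay; apply: Cn_mul.
- apply: (Cn_comp (smooth_flat 1 n)); exact: smooth_shift.
- apply: (Cn_comp (smooth_flat 1 n)); exact: smooth_reflect.
Qed.

Let wedge_ge0 (a b t : R) : 0 <= flat 1 (t - a) * flat 1 (b - t) :> R.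
Proof. by rewrite mulr_ge0// flat_ge0. Qed.

Lemma bell01 a b k t : 0 <= bell a b k t <= 1.
Proof.
have /andP[h0 h1] := decay01 k (wedge_ge0 a b t).
by rewrite /bell subr_ge0 h1/= lerBlDr lerDl.
Qed.

Lemma bell_out a b k t : ~~ (a < t < b) -> bell a b k t = 0.
Proof.
rewrite negb_and -!leNgt /bell => /orP[ta|bt].
- by rewrite (eqP (_ : flat 1 (t - a) == 0)) ?flat_eq0 ?subr_le0// mul0r mulr0 oppr0 expR0 subrr.
- by rewrite (eqP (_ : flat 1 (b - t) == 0)) ?flat_eq0 ?subr_le0// !mulr0 oppr0 expR0 subrr.
Qed.

Lemma cvg_bell a b (t : R) : bell a b k t @[k --> \oo] --> ((a < t < b)%R%:R : R).
Proof.
have -> : (a < t < b)%R%:R = 1 - (flat 1 (t - a) * flat 1 (b - t) == 0)%:R :> R.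
  rewrite mulf_eq0 !flat_eq0 !subr_le0 !leNgt -negb_and.
  by case: (_ && _); rewrite /= ?subr0 ?subrr.
by apply: (@cvgB R R^o); [exact: cvg_cst|exact/cvg_expRMn/wedge_ge0].
Qed.

(** A periodic approximation of the indicator of t <= q on [0, 2 pi[. For q in
    that interval its complement there is the arc ]q, 2 pi[, of centre pi + q / 2
    and half-width pi - q / 2; a point of the circle lies in the arc exactly when
    the cosine of its distance to the centre exceeds the cosine of the half-width. *)
Definition periodic_cutoff (q : R) (k : nat) (t : R^o) : R^o :=
  if q < 0 then 0 else if 2 * pi <= q then 1 else
  expR (- (k%:R * flat 1 (cos (t - (pi + q / 2)) - cos (pi - q / 2)))).

Lemma smooth_periodic_cutoff q k : smooth (periodic_cutoff q k).
Proof.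
move=> n; rewrite /periodic_cutoff; case: (q < 0); first exact: Cn_cst.
case: (2 * pi <= q); first exact: Cn_cst.
apply: smooth_decay; apply: (@Cn_comp _ _ n (flat 1) _ (smooth_flat 1 n)).
apply: Cn_add; last exact: Cn_cst.
apply: (@Cn_comp _ _ n (fun t : R^o => cos t : R^o) _ (smooth_sincos n).2).
exact: smooth_shift.
Qed.

Lemma periodic_cutoff01 q k t : 0 <= periodic_cutoff q k t <= 1.
Proof.
rewrite /periodic_cutoff; case: ifPn => _; first by rewrite lexx ler01.
case: ifPn => _; first by rewrite lexx ler01.
exact/decay01/flat_ge0.
Qed.

Lemma periodic_cutoff_periodic q k t : periodic_cutoff q k (t + 2 * pi) = periodic_cutoff q k t.
Proof.
rewrite /periodic_cutoff; case: ifPn => // _; case: ifPn => // _.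
rewrite (_ : t + 2 * pi - (pi + q / 2) = t - (pi + q / 2) + pi *+ 2).
  by rewrite cosD2pi.
by rewrite -mulr_natl; ring.
Qed.

Lemma cvg_periodic_cutoff q (t : R) : 0 <= t < 2 * pi ->
  periodic_cutoff q k t @[k --> \oo] --> ((t <= q)%R%:R : R).
Proof.
move=> /andP[t0 t2pi]; rewrite /periodic_cutoff.
have [q0|q0] := ltP q 0.
  by rewrite leNgt (lt_le_trans q0 t0)/=; exact: cvg_cst.
have [qpi|qpi] := leP (2 * pi) q.
  by rewrite (le_trans (ltW t2pi) qpi); exact: cvg_cst.
set c := flat _ _.
have -> : (t <= q) = (c == 0); last exact/cvg_expRMn/flat_ge0.
rewrite /c flat_eq0 subr_le0 -cos_norm.
(* Both angles are brought into [0, pi], where the cosine decreases. *)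
have cos_le (x y : R) : 0 <= x <= pi -> 0 <= y <= pi ->
    (cos x <= cos y) = (y <= x).
  by move=> xI yI; rewrite leNgt ltr_cos ?in_itv// -leNgt.
have hf : 0 <= pi - q / 2 <= pi by apply/andP; split; lra.
have [tq|qt] := leP t q; apply/esym.
- have d0 : 0 <= pi + q / 2 - t by lra.
  have -> : `|t - (pi + q / 2)| = pi + q / 2 - t by rewrite distrC ger0_norm.
  have [le_pi|gt_pi] := leP (pi + q / 2 - t) pi.
    by rewrite cos_le// ?d0//; lra.
  have -> : cos (pi + q / 2 - t) = cos (pi - q / 2 + t).
    by rewrite -cosN -cosD2pi -mulr_natl; congr cos; ring.
  rewrite cos_le//; first lra.
  by apply/andP; split; lra.
- have dlt : `|t - (pi + q / 2)| < pi - q / 2.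
    by rewrite ltr_norml; apply/andP; split; lra.
  apply/negbTE; rewrite -ltNge ltr_cos ?in_itv//= normr_ge0/=.
  by rewrite (le_trans (ltW dlt))//; case/andP: hf.
Qed.

End smoothed_indicators.

(** * Antiderivatives of compactly supported functions *)

Section antiderivative.
Context {R : realType}.
Local Notation mu := (@lebesgue_measure R).

(** Integrating from -oo gives an antiderivative that vanishes to the left of
    the support and is constant to its right. *)
Lemma compact_support_antiderivative (f : R -> R) (a b : R) :
  continuous f -> (forall t, ~~ (a < t < b) -> f t = 0) ->
  exists F : R -> R,
    [/\ forall t : R, is_derive (t : R^o) (1 : R^o) (F : R^o -> R^o) (f t),
        forall t, t <= a -> F t = 0 &
        exists c, forall t, b <= t -> F t = c].
Proof.
move=> fc f0.
have f_int : mu.-integrable setT (EFin \o f).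
  have -> : EFin \o f = (EFin \o f) \_ `[a, b].
    apply/funext => t; rewrite patchE /=.
    case: ifPn => //; rewrite notin_setE /= in_itv/= => /negP tab.
    by rewrite f0//; apply: contra tab => /andP[/ltW -> /ltW ->].
  refine (iffLR (@integrable_mkcond _ _ R mu `[a, b]%classic (EFin \o f) _) _) => //.
  refine (@continuous_compact_integrable R f `[a, b]%classic _ _).
    exact: segment_compact.
  exact: continuous_subspaceT.
pose F t := \int[mu]_(s in `]-oo, t]) f s.
exists F; split=> [t|t ta|].
- have t1 : t < t + 1 by rewrite ltrDl.
  have int_t1 : mu.-integrable [set` Interval -oo%O (BRight (t + 1))] (EFin \o f).
    exact: integrableS f_int.
  have [dF] : derivable F t 1 /\ F^`()%classic t = f t.
    refine (@continuous_FTC1 R f _ t _ t1 int_t1 _ (fc t)).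
    by rewrite /= ltNyr.
  by rewrite derive1E => FE; apply: DeriveDef.
- transitivity (\int[mu]_(s in `]-oo, t]) (fun=> 0 : R) s).
    apply: eq_Rintegral => s; rewrite inE /= in_itv/= => st.
    by rewrite f0// negb_and -!leNgt (le_trans st ta).
  by rewrite Rintegral_cst// mul0r.
- exists (\int[mu]_s f s) => t bt.
  suff fE : f \_ `]-oo, t] = f by rewrite /F Rintegral_mkcond fE.
  apply/funext => s; rewrite patchE.
  case: ifPn => //; rewrite notin_setE /= in_itv/= => /negP.
  rewrite -ltNge => ts; rewrite f0// negb_and -!leNgt orbC (le_trans bt)//.
  exact: ltW.
Qed.

End antiderivative.

(** * Boxes and the product measures *)

Section vector_boxes.
Context {R : realType}.

Definition vbox n (A : 'I_n -> set R) : set 'rV[R]_n :=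
  [set x | forall i, A i (x ord0 i)].

Lemma measurable_vbox n (A : 'I_n -> set R) :
  (forall i, measurable (A i)) -> measurable (vbox A).
Proof.
move=> mA.
have -> : vbox A = \bigcap_(i in [set: 'I_n]) ((fun x : 'rV[R]_n => x ord0 i) @^-1` A i).
  by apply/seteqP; split=> x Ax i; [move=> _; exact: Ax|exact: Ax].
apply: fin_bigcap_measurable => // i _.
by rewrite -[X in measurable X]setTI; exact: measurable_coord.
Qed.

Lemma cons_rVE n (t : R) (x : 'rV[R]_n) :
  cons_rV (t, x) ord0 ord0 = t /\
  forall i, cons_rV (t, x) ord0 (lift ord0 i) = x ord0 i.
Proof.
have [t0 xs] := cons_rVK (t, x); split=> // i.
by move/rowP : xs => /(_ i); rewrite mxE.
Qed.

(** The one formula for the power measures on which all later volume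
    computations rest. *)
Lemma power_measure_vbox n (nu : {sigma_finite_measure set (measurableTypeR R) -> \bar R})
    (A : 'I_n -> set R) : (forall i, measurable (A i)) ->
  power_measure nu n (vbox A) = \big[*%E/1%E]_(i < n) nu (A i).
Proof.
elim: n A => [|n ih] A mA.
  by rewrite big_ord0 /= diracE mem_set//; case.
rewrite big_ord_recl /= /cons_measure /pushforward.
have -> : @cons_rV R n @^-1` vbox A = A ord0 `*` vbox (fun i => A (lift ord0 i)).
  apply/seteqP; split=> -[t x]; have [t0 xs] := cons_rVE t x.
    move=> Atx; split => [|i] /=; first by rewrite -t0; exact: Atx.
    by rewrite -xs; exact: Atx.
  move=> [/= A0 As] i; have [->|[j ->]] : i = ord0 \/ exists j, i = lift ord0 j.
  - by case: (unliftP ord0 i) => [j ->|->]; [right; exists j|left].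
  - by rewrite t0.
  - by rewrite xs; exact: As.
have mA' (i : 'I_n) : measurable (A (lift ord0 i)) by exact: mA.
rewrite product_measure1E; [|exact: mA|exact: measurable_vbox].
by rewrite ih.
Qed.

End vector_boxes.

Section boxes.
Context {R : realType} {d m : nat}.
Local Notation X := ('rV[R]_d * 'rV[R]_m)%type.

(** Half-lines are used in y because the measure sees only the cell [0, 2 pi[,
    on which their indicators are limits of periodic smooth functions at every
    point; an arc with endpoint 0 would fail at 0. *)
Definition open_box (a b : 'I_d -> R) (q : 'I_m -> R) : set X :=
  vbox (fun i => `]a i, b i[%classic) `*` vbox (fun j => `]-oo, q j]%classic).

Definition open_boxes : set (set X) :=
  [set A | exists a b q, A = open_box a b q].

Lemma measurable_open_box a b q : measurable (open_box a b q).
Proof.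
by apply: measurableX; apply: measurable_vbox => i; exact: measurable_itv.
Qed.

Lemma open_boxE a b q (z : X) : open_box a b q z <->
  (forall i, a i < z.1 ord0 i < b i) /\ (forall j, z.2 ord0 j <= q j).
Proof.
split=> -[/= h k]; split=> i /=.
- by have := h i; rewrite /= in_itv.
- by have := k i; rewrite /= in_itv.
- by rewrite in_itv; exact: h.
- by rewrite in_itv; exact: k.
Qed.

Lemma setI_closed_open_boxes : setI_closed open_boxes.
Proof.
move=> _ _ [a [b [q ->]]] [a' [b' [q' ->]]].
exists (fun i => Num.max (a i) (a' i)), (fun i => Num.min (b i) (b' i)),
  (fun j => Num.min (q j) (q' j)).
apply/seteqP; split=> z.
  move=> [/open_boxE[h k] /open_boxE[h' k']]; apply/open_boxE; split=> i.
    have /andP[h1 h2] := h i; have /andP[h'1 h'2] := h' i.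
    by rewrite gt_max lt_min h1 h2 h'1 h'2.
  by rewrite le_min k k'.
move=> /open_boxE[h k]; split; apply/open_boxE; split=> i.
- by move: (h i); rewrite gt_max lt_min => /andP[/andP[-> _] /andP[-> _]].
- by move: (k i); rewrite le_min => /andP[].
- by move: (h i); rewrite gt_max lt_min => /andP[/andP[_ ->] /andP[_ ->]].
- by move: (k i); rewrite le_min => /andP[].
Qed.

Lemma open_box_cover :
  \bigcup_k open_box (fun=> - k%:R) (fun=> k%:R) (fun=> k%:R) = [set: X].
Proof.
apply/seteqP; split=> // z _.
pose M := \sum_i `|z.1 ord0 i| + \sum_j `|z.2 ord0 j|.
have le_x i : `|z.1 ord0 i| <= M.
  by rewrite /M (bigD1 i)//= -addrA lerDl addr_ge0// ?addr_ge0 ?sumr_ge0.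
have le_y j : `|z.2 ord0 j| <= M.
  by rewrite /M addrC (bigD1 j)//= -addrA lerDl addr_ge0// ?addr_ge0 ?sumr_ge0.
have [k Mk] : exists k : nat, M < k%:R.
  by exists (Num.bound M); rewrite archi_boundP// addr_ge0// sumr_ge0.
exists k => //; apply/open_boxE; split=> i.
  by rewrite -ltr_norml (le_lt_trans (le_x i)).
by rewrite (le_trans (ler_norm _))// (le_trans (le_y i))// ltW.
Qed.

End boxes.

Section box_generation.
Context {R : realType} {d m : nat}.
Local Notation X := ('rV[R]_d * 'rV[R]_m)%type.

(** It is enough to find the half-spaces of each coordinate inside the generated
    sigma-algebra: for an x-coordinate they are unions of boxes, for a
    y-coordinate unions of differences of boxes. *)
Lemma measurable_open_boxesE : @measurable _ X = <<s @open_boxes R d m >>.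
Proof.
apply/seteqP; split; last first.
  apply: smallest_sub; first exact: sigma_algebra_measurable.
  by move=> _ [a [b [q ->]]]; exact: measurable_open_box.
pose Y := g_sigma_algebraType (@open_boxes R d m).
pose I : Y -> X := id.
(* Measurability may be tested inside each box of the exhausting sequence. *)
have cover (A : set Y) :
    (forall k : nat, measurable (A `&`
       (open_box (fun=> - k%:R) (fun=> k%:R) (fun=> k%:R) : set Y))) ->
    measurable A.
  move=> mA; rewrite -[A]setIT -open_box_cover setI_bigcupr.
  exact: bigcup_measurable.
have mbox a b q : measurable (open_box a b q : set Y).
  by apply: sub_sigma_algebra; exists a, b, q.
have gen (f : Y -> R) : (forall t, measurable (f @^-1` `]t, +oo[%classic)) ->
    measurable_fun setT f.
  move=> mf; apply: (measurability _ (RGenOInfty.measurableE R)).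
  by move=> _ [_ [t ->] <-]; rewrite setTI.
suff mI : measurable_fun setT I.
  by move=> A mA; have := mI measurableT A mA; rewrite setTI.
apply/measurable_fun_pairP; split; apply: measurable_fun_rV => i;
  apply: gen => t; apply: cover => k.
- have -> : (fun z : Y => (fst \o I) z ord0 i) @^-1` `]t, +oo[ `&`
      open_box (fun=> - k%:R) (fun=> k%:R) (fun=> k%:R) =
    open_box (fun j => if j == i then Num.max t (- k%:R) else - k%:R)
      (fun=> k%:R) (fun=> k%:R); last exact: mbox.
  apply/seteqP; split=> z.
    rewrite /= in_itv/= andbT => -[tz /open_boxE[zx zy]].
    apply/open_boxE; split=> // j; case: eqP => [->|_]; last exact: zx.
    by rewrite gt_max tz zx.
  move=> /open_boxE[zx zy].
  have := zx i; rewrite eqxx gt_max => /andP[/andP[tz _] _].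
  rewrite /= in_itv/= andbT; split=> //.
  apply/open_boxE; split=> // j.
  by have := zx j; case: ifP => // _; rewrite gt_max => /andP[/andP[_ ->] ->].
- rewrite (_ : _ `&` _ =
    open_box (fun=> - k%:R) (fun=> k%:R) (fun=> k%:R) `\`
    open_box (fun=> - k%:R) (fun=> k%:R) (fun j => if j == i then Num.min t k%:R else k%:R)).
    exact: measurableD.
  apply/seteqP; split=> z.
    rewrite /= in_itv/= andbT => -[tz zb]; split=> // /open_boxE[_ /(_ i)].
    by rewrite eqxx le_min leNgt tz.
  move=> [zb zNb]; split=> //.
  rewrite /= in_itv/= andbT ltNge; apply/negP => zt; apply: zNb.
  move/open_boxE : zb => [zx zy]; apply/open_boxE; split=> // j.
  by case: eqP => [->|_]; rewrite ?le_min ?zy ?zt.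
Qed.

(** The uniqueness principle behind both the change of variables and the
    fundamental lemma. *)
Lemma eq_measure_open_boxes (m1 m2 : {measure set X -> \bar R}) :
  (forall a b q, m1 (open_box a b q) = m2 (open_box a b q)) ->
  (forall a b q, (m1 (open_box a b q) < +oo)%E) ->
  forall A, measurable A -> m1 A = m2 A.
Proof.
move=> m12 m1oo; apply: (measure_unique (@open_boxes R d m)
  (fun k => open_box (fun=> - k%:R) (fun=> k%:R) (fun=> k%:R))).
- exact: measurable_open_boxesE.
- exact: setI_closed_open_boxes.
- by move=> k; do 3!eexists.
- exact: open_box_cover.
- by move=> _ [a [b [q ->]]].
- by move=> k.
Qed.

End box_generation.

Section cylinder_measure_boxes.
Context {R : realType} {d m : nat}.
Local Notation X := ('rV[R]_d * 'rV[R]_m)%type.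
Local Notation cyl := (@cyl_measure R d m).

Lemma cyl_measure_open_box a b q : cyl (open_box a b q) =
  (\big[*%E/1%E]_(i < d) lebesgue_measure `]a i, b i[%classic *
   \big[*%E/1%E]_(j < m) circle_measure `]-oo, q j]%classic)%E.
Proof.
rewrite /cyl_measure product_measure1E; last 2 first.
- by apply: measurable_vbox => i; exact: measurable_itv.
- by apply: measurable_vbox => i; exact: measurable_itv.
by congr (_ * _)%E; apply: power_measure_vbox => i; exact: measurable_itv.
Qed.

Lemma prode_fin_num n (F : 'I_n -> \bar R) : (forall i, F i \is a fin_num) ->
  \big[*%E/1%E]_(i < n) F i \is a fin_num.
Proof. by move=> Ffin; elim/big_rec : _ => // i x _ xfin; rewrite fin_numM. Qed.

Lemma cyl_measure_open_box_lty a b q : (cyl (open_box a b q) < +oo)%E.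
Proof.
rewrite cyl_measure_open_box -ge0_fin_numE; last first.
  by rewrite mule_ge0// prode_ge0.
rewrite fin_numM// prode_fin_num// => i.
- rewrite lebesgue_measure_itv/=; case: ifP => //.
- by rewrite fin_num_measure//; exact: measurable_itv.
Qed.

Lemma cyl_measure_cell : {ae cyl, forall z : X, forall j, 0 <= z.2 ord0 j < 2 * pi}.
Proof.
apply: filter_forall => j.
pose B (k : 'I_m) : set R := if k == j then ~` `[0, 2 * pi[%classic else setT.
have mB k : measurable (B k).
  by rewrite /B; case: ifP => // _; apply: measurableC; exact: measurable_itv.
exists (setT `*` vbox B); split.
- by apply: measurableX => //; exact: measurable_vbox.
- rewrite /cyl_measure product_measure1E//; last exact: measurable_vbox.
  rewrite power_measure_vbox// (bigD1 j)//= {1}/B eqxx.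
  by rewrite /circle_measure /mrestr setICl measure0 mul0e mule0.
- move=> z /= zj; split=> //= k; rewrite /B; case: eqP => [->|//].
  by rewrite /= in_itv.
Qed.

End cylinder_measure_boxes.

(** * Dilations of the noncompact variable *)

Section dilation.
Context {R : realType} {d m : nat}.
Local Notation X := ('rV[R]_d * 'rV[R]_m)%type.
Local Notation cyl := (@cyl_measure R d m).

Definition dilate (b : R) (z : X) : X := (b *: z.1, z.2).

Lemma measurable_dilate b : measurable_fun [set: X] (dilate b).
Proof.
apply/measurable_fun_pairP; split; last exact: measurable_snd.
apply: measurable_fun_rV => i; under eq_fun do rewrite /= mxE.
apply: measurable_funM => //.
exact: (measurableT_comp (measurable_coord i) measurable_fst).
Qed.

Lemma dilateK b : b != 0 -> cancel (dilate b) (dilate b^-1).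
Proof. by move=> b0 [x y]; rewrite /dilate /= scalerA mulVf// scale1r. Qed.

(** Both sides are measures in A, so boxes suffice. *)
Lemma cyl_measure_dilate (b : R) (A : set X) : 0 < b -> measurable A ->
  cyl (dilate b @^-1` A) = ((b ^+ d)^-1%:E * cyl A)%E.
Proof.
move=> b0 mA.
have bd0 : 0 <= (b ^+ d)^-1 by rewrite invr_ge0 exprn_ge0// ltW.
pose push : {measure set X -> \bar R} := pushforward cyl (dilate b).
pose m1 := push (measurable_dilate b).
pose m2 : {measure set X -> \bar R} := mscale (NngNum bd0) cyl.
have same_boxes p q r : m1 (open_box p q r) = m2 (open_box p q r).
  rewrite /m1 /m2 /push /= /pushforward /mscale/=.
  have -> : dilate b @^-1` open_box p q r =
      open_box (fun i => p i / b) (fun i => q i / b) r.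
    apply/seteqP; split=> z /open_boxE[zx zy]; apply/open_boxE; split=> // i.
      by have := zx i; rewrite /= mxE ltr_pdivrMr// ltr_pdivlMr// mulrC.
    by have := zx i; rewrite /= mxE ltr_pdivrMr// ltr_pdivlMr// mulrC.
  rewrite !cyl_measure_open_box muleA; congr (_ * _)%E.
  have -> : (b ^+ d)^-1%:E = (\big[*%E/1%E]_(i < d) b^-1%:E)%E.
    by rewrite prodEFin prodr_const card_ord exprVn.
  rewrite -big_split/=; apply: eq_bigr => i _.
  rewrite !lebesgue_measure_itv/= !lte_fin ltr_pM2r ?invr_gt0//.
  case: ifP => _; last by rewrite mule0.
  by rewrite -!EFinB -EFinM; congr EFin; field; rewrite gt_eqF.
apply: (@eq_measure_open_boxes _ _ _ m1 m2) => // p q r.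
rewrite same_boxes.
by rewrite /m2 /= /mscale/= lte_mul_pinfty// cyl_measure_open_box_lty.
Qed.

End dilation.

(** * Change of variables for arbitrary integrands *)

Section change_of_variables.
Local Open Scope ereal_scope.
Context {disp : measure_display} {T : measurableType disp} {R : realType}.
Variable mu : {measure set T -> \bar R}.
Import HBNNSimple.

(** The integral of a nonnegative function is a supremum over simple functions
    below it, and composing with f carries simple functions below h to simple
    functions below h o f. *)
Let ge0_integral_le_comp (f : T -> T) (k : R) (h : T -> \bar R) :
  measurable_fun setT f -> (0 < k)%R ->
  (forall A, measurable A -> mu (f @^-1` A) = k%:E * mu A) ->
  (forall z, 0 <= h z) ->
  \int[mu]_z h z <= k^-1%:E * \int[mu]_z h (f z).
Proof.
move=> mf k0 muf h0.
rewrite !ge0_integralTE//; apply: ge_ereal_sup => _ /= [g gh <-].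
have mgf : measurable_fun setT (g \o f) by exact: measurableT_comp.
have gf_fin : finite_set (range (g \o f)).
  by apply: sub_finite_set (@fimfunP _ _ g) => _ [z _ <-]; exists (f z).
have gf_ge0 z : (0 <= (g \o f) z)%R by exact: fun_ge0.
pose gf : {nnsfun T >-> R} := HB.pack (g \o f)
  (isMeasurableFun.Build _ _ _ _ (g \o f) mgf) (FiniteImage.Build _ _ (g \o f) gf_fin)
  (isNonNegFun.Build _ _ (g \o f) gf_ge0).
have gfE : sintegral mu gf = k%:E * sintegral mu g.
  rewrite /sintegral ge0_mule_fsumr; last by move=> x; exact: nnsfun_mulemu_ge0.
  apply: eq_fsbigr => x _; rewrite muleCA; congr (_ * _).
  rewrite -[LHS]/(mu (f @^-1` (g @^-1` [set x]))) muf//.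
have -> : sintegral mu g = k^-1%:E * sintegral mu gf.
  by rewrite gfE muleA -EFinM mulVf ?mul1e// gt_eqF.
rewrite lee_wpmul2l ?lee_fin ?invr_ge0 ?(ltW k0)//.
by apply: ereal_sup_ubound; exists gf => // z; exact: gh.
Qed.

(** Distributivity is checked by cases because it must also hold for the
    indeterminate difference of two infinities. *)
Let gt0_muleBr (k : R) (x y : \bar R) : (0 < k)%R ->
  k%:E * (x - y) = k%:E * x - k%:E * y.
Proof.
move=> k0.
have ky : k%:E * +oo = +oo by rewrite gt0_muley ?lte_fin.
have kNy : k%:E * -oo = -oo by rewrite gt0_muleNy ?lte_fin.
case: x y => [x| |] [y| |]; rewrite ?ky ?kNy//.
by rewrite -EFinD -!EFinM -EFinD mulrBr.
Qed.

Variables (f g : T -> T) (k : R).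
Hypotheses (mf : measurable_fun setT f) (mg : measurable_fun setT g).
Hypotheses (fK : cancel f g) (gK : cancel g f) (k0 : (0 < k)%R).
Hypothesis muf : forall A, measurable A -> mu (f @^-1` A) = k%:E * mu A.

Let ge0_integral_comp_bij (h : T -> \bar R) : (forall z, 0 <= h z) ->
  \int[mu]_z h (f z) = k%:E * \int[mu]_z h z.
Proof.
move=> h0; apply/eqP; rewrite eq_le; apply/andP; split.
- have mug A : measurable A -> mu (g @^-1` A) = k^-1%:E * mu A.
    move=> mA; have mgA : measurable (g @^-1` A) by rewrite -[X in measurable X]setTI; exact: mg.
    have -> : mu A = k%:E * mu (g @^-1` A).
      by rewrite -muf//; congr (mu _); apply/seteqP; split=> z /=; rewrite fK.
    by rewrite muleA -EFinM mulVf ?mul1e// gt_eqF.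
  have kV0 : (0 < k^-1)%R by rewrite invr_gt0.
  have := @ge0_integral_le_comp g k^-1 (h \o f) mg kV0 mug (fun z => h0 (f z)).
  rewrite invrK => /le_trans; apply; apply: lee_wpmul2l; first by rewrite lee_fin ltW.
  by under [leLHS]eq_integral do rewrite /= gK.
- have := ge0_integral_le_comp mf k0 muf h0.
  rewrite -(@lee_pmul2l _ k%:E) ?lte_fin// muleA -EFinM divff ?gt_eqF// mul1e.
  by [].
Qed.

(** The integrand is arbitrary so as to cover products with derivatives of
    arbitrary test functions. The reverse inequality is the direct one for the
    inverse map. *)
Lemma integral_comp_bij (h : T -> \bar R) :
  \int[mu]_z h (f z) = k%:E * \int[mu]_z h z.
Proof.
rewrite integralE [in RHS]integralE.
have -> : (fun z => h (f z))^\+ = h^\+ \o f by apply/funext => z; rewrite /= !funeposE.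
have -> : (fun z => h (f z))^\- = h^\- \o f by apply/funext => z; rewrite /= !funenegE.
have hp := ge0_integral_comp_bij (funepos_ge0 h).
have hn := ge0_integral_comp_bij (funeneg_ge0 h).
rewrite /= hp hn.
by rewrite [RHS]gt0_muleBr.
Qed.

End change_of_variables.

(** * Test functions of product form *)

Section tensor_test_functions.
Context {R : realType} {d m : nat}.
Local Notation X := ('rV[R]_d * 'rV[R]_m)%type.
Implicit Types (f : 'I_d -> R^o -> R^o) (g : 'I_m -> R^o -> R^o).

Definition tensor f g (z : X) : R^o :=
  (\prod_i f i (z.1 ord0 i)) * \prod_j g j (z.2 ord0 j).

Let continuous_coord n (i : 'I_n) : continuous (fun x : 'rV[R]_n => x ord0 i : R^o).
Proof. exact: coord_continuous. Qed.

Lemma smooth_coord1 n (h : R^o -> R^o) i : Cn n h ->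
  Cn n (fun z : X => h (z.1 ord0 i)).
Proof.
apply: (@Cn_affine R X R^o (fun z => z.1 ord0 i) (fun z => z.1 ord0 i)).
  by move=> k v z /=; rewrite !mxE.
move=> z; apply: (@continuous_comp _ _ _ fst (fun x : 'rV[R]_d => x ord0 i : R^o)).
  exact: cvg_fst.
exact: continuous_coord.
Qed.

Lemma smooth_coord2 n (h : R^o -> R^o) j : Cn n h ->
  Cn n (fun z : X => h (z.2 ord0 j)).
Proof.
apply: (@Cn_affine R X R^o (fun z => z.2 ord0 j) (fun z => z.2 ord0 j)).
  by move=> k v z /=; rewrite !mxE.
move=> z; apply: (@continuous_comp _ _ _ snd (fun x : 'rV[R]_m => x ord0 j : R^o)).
  exact: cvg_snd.
exact: continuous_coord.
Qed.

Lemma smooth_tensor f g : (forall i, smooth (f i)) -> (forall j, smooth (g j)) ->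
  smooth (tensor f g).
Proof.
move=> fs gs n; apply: Cn_mul; apply: Cn_prod => i.
- by apply: smooth_coord1; exact: fs.
- by apply: smooth_coord2; exact: gs.
Qed.

Lemma measurable_tensor f g : (forall i, smooth (f i)) -> (forall j, smooth (g j)) ->
  measurable_fun [set: X] (tensor f g : X -> R).
Proof.
move=> fs gs; apply: measurable_funM; apply: measurable_prod => i _.
- apply: (@measurableT_comp _ _ _ _ _ _ (f i : R -> R)).
    by apply: continuous_measurable_fun; exact: (fs i 0%N).
  exact: (measurableT_comp (measurable_coord i) measurable_fst).
- apply: (@measurableT_comp _ _ _ _ _ _ (g i : R -> R)).
    by apply: continuous_measurable_fun; exact: (gs i 0%N).
  exact: (measurableT_comp (measurable_coord i) measurable_snd).
Qed.

(** Compact support in x: a point of norm larger than the sum of the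
    moduli of all endpoints has a coordinate outside its interval. *)
Lemma test_function_tensor (a b : 'I_d -> R) f g :
  (forall i, smooth (f i)) -> (forall j, smooth (g j)) ->
  (forall i t, ~~ (a i < t < b i) -> f i t = 0) ->
  (forall j t, g j (t + 2 * pi) = g j t) ->
  test_function (tensor f g).
Proof.
move=> fs gs f0 gper; split; first exact: smooth_tensor.
- move=> x y j; rewrite /tensor /=; congr (_ * _); apply: eq_bigr => k _.
  rewrite !mxE eqxx /=; case: eqP => [->|_]; first by rewrite mulr1 gper.
  by rewrite mulr0 addr0.
- exists (\sum_i (`|a i| + `|b i|)) => x y rx.
  have r_ge i : `|a i| + `|b i| <= \sum_i (`|a i| + `|b i|).
    by rewrite (bigD1 i)//= lerDl sumr_ge0// => j _; rewrite addr_ge0.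
  (* The norm of x is the modulus of one of its coordinates. *)
  have [i xi] : exists i, \sum_i (`|a i| + `|b i|) < `|x ord0 i|.
    have : mx_norm x != 0.
      have r0 : 0 <= \sum_i (`|a i| + `|b i|).
        by apply: sumr_ge0 => i _; rewrite addr_ge0.
      by rewrite gt_eqF// (le_lt_trans r0 rx).
    move=> /mx_norm_neq0[[k i] /= xE]; exists i.
    by rewrite (ord1 k) in xE; rewrite -xE.
  rewrite /tensor /= (bigD1 i)//= f0 ?mul0r//.
  have := le_lt_trans (r_ge i) xi.
  rewrite negb_and -!leNgt => abx; have [x0|x0] := leP 0 (x ord0 i).
    apply/orP; right; move: abx; rewrite (ger0_norm x0).
    by have := normr_ge0 (a i); have := ler_norm (b i); lra.
  apply/orP; left; move: abx; rewrite (ltr0_norm x0).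
  by have := normr_ge0 (b i); have := ler_norm (- a i); rewrite normrN; lra.
Qed.

End tensor_test_functions.

Section box_bumps.
Context {R : realType} {d m : nat}.
Local Notation X := ('rV[R]_d * 'rV[R]_m)%type.
Implicit Types (a b : 'I_d -> R) (q : 'I_m -> R).

Definition box_bump a b q (k : nat) : X -> R^o :=
  tensor (fun i => bell (a i) (b i) k) (fun j => periodic_cutoff (q j) k).

Let prod01 n (F : 'I_n -> R) : (forall i, 0 <= F i <= 1) ->
  0 <= \prod_i F i <= 1.
Proof.
move=> F01; rewrite prodr_ge0 => [|i _]; last by case/andP: (F01 i).
by rewrite prodr_ile1// => i _.
Qed.

Let cvg_prodr n (F : nat -> 'I_n -> R) (G : 'I_n -> R) :
  (forall i, F k i @[k --> \oo] --> G i) ->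
  \prod_i F k i @[k --> \oo] --> \prod_i G i.
Proof.
move=> FG; elim: (index_enum _) => [|i r ih].
  by rewrite big_nil; under eq_cvg do rewrite big_nil; exact: cvg_cst.
rewrite big_cons; under eq_cvg do rewrite big_cons.
exact: (@cvgM R).
Qed.

Lemma box_bump01 a b q k z : 0 <= box_bump a b q k z <= 1.
Proof.
have /andP[x0 x1] := prod01 (fun i => bell01 (a i) (b i) k (z.1 ord0 i)).
have /andP[y0 y1] := prod01 (fun j => periodic_cutoff01 (q j) k (z.2 ord0 j)).
by rewrite mulr_ge0//= mulr_ile1.
Qed.

Lemma box_bump_out a b q k (z : X) i : ~~ (a i < z.1 ord0 i < b i) -> box_bump a b q k z = 0.
Proof. by move=> zi; rewrite /box_bump /tensor (bigD1 i)//= bell_out// !mul0r. Qed.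

(** The limit is only claimed over the cell; elsewhere the limit is periodic in
    y whereas the box is not. *)
Lemma cvg_box_bump a b q (z : X) : (forall j, 0 <= z.2 ord0 j < 2 * pi) ->
  box_bump a b q k z @[k --> \oo] --> (\1_(open_box a b q) z : R).
Proof.
move=> zcell.
have -> : \1_(open_box a b q) z =
    (\prod_i (a i < z.1 ord0 i < b i)%R%:R) *
    (\prod_j (z.2 ord0 j <= q j)%R%:R) :> R.
  rewrite indicE; have [|zNb] := boolP (z \in open_box a b q).
    rewrite inE => /open_boxE[zx zy].
    by rewrite !big1 ?mulr1// => i _; rewrite ?zx ?zy.
  apply/esym/eqP; rewrite mulf_eq0; apply/orP.
  have [/forallP zx|] := boolP [forall i, a i < z.1 ord0 i < b i].
    have [/forallP zy|] := boolP [forall j, z.2 ord0 j <= q j].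
      by move: zNb; rewrite notin_setE => /open_boxE[].
    by rewrite negb_forall => /existsP[j /negbTE zj]; right; rewrite (bigD1 j)//= zj mul0r.
  by rewrite negb_forall => /existsP[j /negbTE zj]; left; rewrite (bigD1 j)//= zj mul0r.
apply: (@cvgM R).
- by apply: cvg_prodr => i; exact: cvg_bell.
- by apply: cvg_prodr => j; exact: cvg_periodic_cutoff.
Qed.

Lemma measurable_box_bump a b q k : measurable_fun [set: X] (box_bump a b q k : X -> R).
Proof.
by apply: measurable_tensor => i; [exact: smooth_bell|exact: smooth_periodic_cutoff].
Qed.

Lemma test_function_box_bump a b q k : test_function (box_bump a b q k).
Proof.
apply: (@test_function_tensor _ _ _ a b) => i.
- exact: smooth_bell.
- exact: smooth_periodic_cutoff.
- by move=> t; exact: bell_out.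
- by move=> t; exact: periodic_cutoff_periodic.
Qed.

End box_bumps.

(** * The fundamental lemma of the calculus of variations *)

Section square_integrable.
Context {R : realType} {d m : nat}.
Local Notation X := ('rV[R]_d * 'rV[R]_m)%type.
Local Notation cyl := (@cyl_measure R d m).
Implicit Types (w : X -> R) (a b : 'I_d -> R) (q : 'I_m -> R).

(** Real and imaginary parts of L^2 functions are treated separately, hence a
    real-valued notion. *)
Definition sq_integrable w := measurable_fun [set: X] w /\
  (\int[cyl]_z ((w z) ^+ 2)%:E < +oo)%E.

(** The support in x of the bumps over a box. *)
Definition strip a b : set X := vbox (fun i => `]a i, b i[%classic) `*` setT.

Lemma measurable_strip a b : measurable (strip a b).
Proof.
by apply: measurableX => //; apply: measurable_vbox => i; exact: measurable_itv.
Qed.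

Lemma cyl_measure_strip a b : cyl (strip a b) =
  (\big[*%E/1%E]_(i < d) lebesgue_measure `]a i, b i[%classic *
   \big[*%E/1%E]_(j < m) circle_measure [set: R])%E.
Proof.
rewrite /cyl_measure product_measure1E//; last first.
  by apply: measurable_vbox => i; exact: measurable_itv.
have -> : [set: 'rV[R]_m] = vbox (fun=> [set: R]) by apply/seteqP; split.
congr (_ * _)%E; apply: power_measure_vbox => i; last exact: measurableT.
exact: measurable_itv.
Qed.

Lemma cyl_measure_strip_lty a b : (cyl (strip a b) < +oo)%E.
Proof.
rewrite cyl_measure_strip -ge0_fin_numE; last first.
  by rewrite mule_ge0// prode_ge0.
rewrite fin_numM// prode_fin_num// => i.
- by rewrite lebesgue_measure_itv/=; case: ifP.
- by rewrite fin_num_measure//; exact: measurableT.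
Qed.

Lemma box_bump_strip a b q k z : box_bump a b q k z <= \1_(strip a b) z.
Proof.
rewrite indicE; have [zS|] := boolP (z \in strip a b).
  by case/andP: (box_bump01 a b q k z).
rewrite notin_setE => zNS; have [i zi] : exists i, ~~ (a i < z.1 ord0 i < b i).
  apply/existsP; rewrite -negb_forall; apply/negP => /forallP zS; apply: zNS.
  by split=> // i; rewrite /= in_itv/= zS.
by rewrite (box_bump_out q k zi).
Qed.

Lemma integrable_sq w : sq_integrable w ->
  cyl.-integrable setT (fun z => ((w z) ^+ 2)%:E).
Proof.
move=> [mw w2]; apply/integrableP; split.
  by apply/measurable_EFinP; exact: measurable_funX.
rewrite (eq_integral (fun z => ((w z) ^+ 2)%:E))// => z _.
by rewrite gee0_abs// lee_fin sqr_ge0.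
Qed.

Lemma integrable_strip a b : cyl.-integrable setT (fun z => (\1_(strip a b) z)%:E).
Proof.
apply/integrableP; split.
  by apply/measurable_EFinP; apply: measurable_indic; exact: measurable_strip.
rewrite (eq_integral (fun z => (\1_(strip a b) z)%:E)); last first.
  by move=> z _; rewrite gee0_abs// lee_fin.
by rewrite integral_indic ?setIT ?cyl_measure_strip_lty//; exact: measurable_strip.
Qed.

(** A bound independent of k, by |w| <= w^2 + 1: it dominates the whole sequence
    of bumps approaching the indicator of a box. *)
Lemma norm_mul_box_bump_le w a b q k z :
  `|w z * box_bump a b q k z| <= (w z) ^+ 2 + \1_(strip a b) z.
Proof.
have := box_bump_strip a b q k z; have /andP[c0 c1] := box_bump01 a b q k z.
rewrite normrM (ger0_norm c0); move: c0 c1.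
set c : R := box_bump _ _ _ _ _ => c0 c1 cS.
have w2 : (w z) ^+ 2 = `|w z| ^+ 2 by rewrite real_normK ?num_real.
rewrite w2; apply: (le_trans (y := `|w z| ^+ 2 + c)); last by rewrite lerD2l.
have := normr_ge0 (w z); nra.
Qed.

Let integrable_bound w a b : sq_integrable w ->
  cyl.-integrable setT (fun z => ((w z) ^+ 2 + \1_(strip a b) z)%:E).
Proof.
move=> w2; rewrite (_ : (fun z => _) = (fun z => ((w z) ^+ 2)%:E) \+
  (fun z => (\1_(strip a b) z)%:E))%E//.
by apply: integrableD => //; [exact: integrable_sq|exact: integrable_strip].
Qed.

Lemma integrable_mul_box_bump w a b q k : sq_integrable w ->
  cyl.-integrable setT (fun z => (w z * box_bump a b q k z)%:E).
Proof.
move=> w2; apply: le_integrable (integrable_bound a b w2) => //.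
  by apply/measurable_EFinP; apply: measurable_funM; [case: w2|exact: measurable_box_bump].
move=> z _ /=; rewrite lee_fin (le_trans (norm_mul_box_bump_le _ _ _ _ _ _))//.
exact: ler_norm.
Qed.

(** Dominated convergence along the bumps of the box. *)
Lemma integral_open_box_eq0 w a b q : sq_integrable w ->
  (forall k, \int[cyl]_z (w z * box_bump a b q k z) = 0) ->
  cyl.-integrable (open_box a b q) (EFin \o w) /\
  (\int[cyl]_(z in open_box a b q) (w z)%:E = 0)%E.
Proof.
move=> w2 w0.
have mw : measurable_fun [set: X] w by case: w2.
pose f k z : \bar R := (w z * box_bump a b q k z)%:E.
pose g z : \bar R := (w z * \1_(open_box a b q) z)%:E.
have mf k : measurable_fun setT (f k).
  exact: measurable_int (integrable_mul_box_bump a b q k w2).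
have mB := measurable_open_box a b q.
have mg : measurable_fun setT g.
  by apply/measurable_EFinP; apply: measurable_funM => //; exact: measurable_indic.
have fg : {ae cyl, forall z, setT z -> f ^~ z @ \oo --> g z}.
  apply: filterS (@cyl_measure_cell R d m) => z zcell _.
  apply: cvg_EFin; first exact: nearW.
  by apply: (@cvgM R); [exact: cvg_cst|exact: cvg_box_bump].
have bnd : {ae cyl, forall z k, setT z ->
    (`|f k z| <= ((w z) ^+ 2 + \1_(strip a b) z)%:E)%E}.
  by apply: nearW => z k _; rewrite lee_fin norm_mul_box_bump_le.
have [g_int _ int_cvg] := dominated_convergence measurableT mf mg fg
  (integrable_bound a b w2) bnd.
have gE : g = (EFin \o w) \_ (open_box a b q).
  apply/funext => z; rewrite patchE /g indicE.
  by case: ifP => zB; rewrite ?mulr1 ?mulr0.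
split; first by apply/(integrable_mkcond _ mB); rewrite -gE.
rewrite integral_mkcond -[in LHS]gE.
rewrite -(cvg_lim _ int_cvg)//; apply: lim_near_cst => //; apply: nearW => k.
rewrite -[LHS]fineK ?integrable_fin_num//; last exact: integrable_mul_box_bump.
exact/congr1/w0.
Qed.

Let density (h : X -> \bar R) (mh : measurable_fun setT h)
    (h0 : forall z, (0 <= h z)%E) :
  exists nu : {measure set X -> \bar R}, forall A, nu A = (\int[cyl]_(z in A) h z)%E.
Proof.
pose nu (A : set X) := (\int[cyl]_(z in A) h z)%E.
have nu0 : nu set0 = 0%E by exact: integral_set0.
have nu_ge0 A : (0 <= nu A)%E by exact: integral_ge0.
have nu_add : semi_sigma_additive nu by exact: semi_sigma_additive_nng_induced.
pose nu' : {measure set X -> \bar R} := HB.pack nu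
  (isMeasure.Build _ _ _ nu nu0 nu_ge0 nu_add).
by exists nu'.
Qed.

(** The positive and the negative part of w are densities of two measures that
    agree on boxes, hence everywhere. Evaluating both on the set where w > 0
    kills the positive part, and then the negative part on the whole space. *)
Lemma orthogonal_box_bump_eq0 w : sq_integrable w ->
  (forall a b q k, \int[cyl]_z (w z * box_bump a b q k z) = 0) ->
  {ae cyl, forall z, w z = 0}.
Proof.
move=> w2 w0.
have mw : measurable_fun [set: X] (EFin \o w) by apply/measurable_EFinP; case: w2.
have mp := measurable_funepos mw; have mn := measurable_funeneg mw.
have [m1 m1E] := density mp (fun z => funepos_ge0 _ z).
have [m2 m2E] := density mn (fun z => funeneg_ge0 _ z).
have m_box a b q : m1 (open_box a b q) = m2 (open_box a b q) /\
    (m1 (open_box a b q) < +oo)%E.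
  have mB := measurable_open_box a b q.
  have [wB] := integral_open_box_eq0 w2 (w0 a b q).
  have pB : (\int[cyl]_(z in open_box a b q) (EFin \o w)^\+ z)%E \is a fin_num.
    exact: (integrable_fin_num mB (integrable_funepos mB wB)).
  have nB : (\int[cyl]_(z in open_box a b q) (EFin \o w)^\- z)%E \is a fin_num.
    exact: (integrable_fin_num mB (integrable_funeneg mB wB)).
  rewrite integralE m1E m2E; move: pB nB.
  move: (integral _ _ _) (integral _ _ _) => [p| |] [n| |] // _ _.
  by rewrite -EFinB => -[/eqP]; rewrite subr_eq0 => /eqP ->; rewrite ltry.
have m12 := eq_measure_open_boxes (fun a b q => (m_box a b q).1)
  (fun a b q => (m_box a b q).2).
pose A := [set z | 0 < w z].
have mA : measurable A.
  rewrite (_ : A = w @^-1` `]0, +oo[%classic); last first.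
    by apply/seteqP; split=> z; rewrite /A /= in_itv/= andbT.
  by rewrite -[X in measurable X]setTI; apply: w2.1.
have p0 : (\int[cyl]_z (EFin \o w)^\+ z = 0)%E.
  transitivity (m1 A).
    rewrite m1E [RHS]integral_mkcond; apply: eq_integral => z _; rewrite patchE.
    case: ifPn => //; rewrite notin_setE => /negP; rewrite -leNgt => wz.
    by rewrite funeposE /=; apply/max_idPr; rewrite lee_fin.
  rewrite m12// m2E; apply: integral0_eq => z wz.
  by rewrite funenegE /=; apply/max_idPr; rewrite lee_fin oppr_le0 ltW.
have n0 : (\int[cyl]_z (EFin \o w)^\- z = 0)%E.
  by move: p0; have := m12 _ measurableT; rewrite m1E m2E => ->.
have : (\int[cyl]_z `|(EFin \o w) z| = 0)%E.
  rewrite (_ : (fun z => _) = (EFin \o w)^\+ \+ (EFin \o w)^\-)%E; last first.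
    by rewrite -fune_abse.
  by rewrite ge0_integralD// p0 n0 adde0.
move/(ae_eq_integral_abs cyl measurableT mw).
by apply: filterS => z /(_ I) [wz].
Qed.

End square_integrable.

(** * Functions with a vanishing weak derivative along an axis *)

Section constant_along_axis.
Context {R : realType} {d m : nat}.
Local Notation X := ('rV[R]_d * 'rV[R]_m)%type.
Local Notation cyl := (@cyl_measure R d m).
Variable i0 : 'I_d.
Implicit Types (a b : 'I_d -> R) (q : 'I_m -> R).

Definition update (F : R^o -> R^o) (f : 'I_d -> R^o -> R^o) (i : 'I_d) : R^o -> R^o :=
  if i == i0 then F else f i.

Let rest (f : 'I_d -> R^o -> R^o) (g : 'I_m -> R^o -> R^o) (z : X) : R^o :=
  (\prod_(i | i != i0) f i (z.1 ord0 i)) * \prod_j g j (z.2 ord0 j).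

Let tensor_update F f g (z : X) :
  tensor (update F f) g z = F (z.1 ord0 i0) * rest f g z.
Proof.
rewrite /tensor /rest (bigD1 i0)//= {1}/update eqxx -mulrA; congr (_ * (_ * _)).
by apply: eq_bigr => i /negbTE ii0; rewrite /update ii0.
Qed.

Let is_derive_rest f g (z : X) : is_derive z (dir_x i0) (rest f g) (0 : R^o).
Proof.
have line (h : R) : rest f g (h *: dir_x i0 + z) = rest f g z.
  rewrite /rest; congr (_ * _); apply: eq_bigr => k.
    by move=> /negbTE ki0; rewrite !mxE ki0 andbF mulr0 add0r.
  by move=> _; rewrite !mxE mulr0 add0r.
have quot0 :
    (fun h : R => h^-1 *: ((rest f g \o shift z) (h *: dir_x i0) - rest f g z)) = cst (0 : R^o).
  by apply/funext => h; rewrite /= line subrr scaler0.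
have q0 : (cst (0 : R^o) : R -> R^o) @ 0^' --> (0 : R^o) by exact: cvg_cst.
apply: DeriveDef; first by rewrite /derivable quot0; apply/cvg_ex; exists 0.
by rewrite /derive quot0; exact/cvg_lim.
Qed.

Let is_derive_axis (z : X) : is_derive z (dir_x i0) (fun z : X => z.1 ord0 i0 : R^o) 1.
Proof.
have aff (h : R) (v w : X) : (h *: v + w).1 ord0 i0 = h *: (v.1 ord0 i0 : R^o) + w.1 ord0 i0.
  by rewrite /= !mxE.
have one : (dir_x i0 : X).1 ord0 i0 = 1 by rewrite /= mxE !eqxx.
apply: DeriveDef.
  apply: (@derivable_affine R X R^o (fun z => z.1 ord0 i0) (fun z => z.1 ord0 i0) aff id).
  exact: derivable_id.
rewrite (@derive_affine R X R^o (fun z => z.1 ord0 i0) (fun z => z.1 ord0 i0) aff id).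
by rewrite derive_id.
Qed.

(** The other factors do not depend on the coordinate i0. *)
Lemma is_derive_tensor_update (F F' : R^o -> R^o) f g (z : X) :
  (forall t : R^o, is_derive t (1 : R^o) F (F' t)) ->
  is_derive z (dir_x i0) (tensor (update F f) g) (tensor (update F' f) g z).
Proof.
move=> dF.
rewrite (_ : tensor (update F f) g = (fun z : X => F (z.1 ord0 i0)) * rest f g); last first.
  by apply/funext => w; rewrite tensor_update.
have dFz := is_derive_comp (dF (z.1 ord0 i0)) (is_derive_axis z).
apply: (is_derive_eq (is_deriveM dFz (is_derive_rest f g z))).
by rewrite scaler0 add0r mulr1 tensor_update [RHS]mulrC.
Qed.

Definition slide (a : 'I_d -> R) (L : R) (i : 'I_d) : R := if i == i0 then a i + L else a i.

Let box_bump_update a b q k : box_bump a b q k =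
  tensor (update (bell (a i0) (b i0) k) (fun i => bell (a i) (b i) k))
    (fun j => periodic_cutoff (q j) k).
Proof.
rewrite /box_bump; congr tensor; apply/funext => i; rewrite /update.
by case: eqP => [->|].
Qed.

Let box_bump_slide a b q k L z : box_bump (slide a L) (slide b L) q k z =
  tensor (update (fun t => bell (a i0) (b i0) k (t - L)) (fun i => bell (a i) (b i) k))
    (fun j => periodic_cutoff (q j) k) z.
Proof.
rewrite /box_bump; congr (tensor _ _ z); apply/funext => i; rewrite /update /slide.
case: eqP => [->|//]; apply/funext => t; rewrite /bell.
have -> : t - (a i0 + L) = t - L - a i0 by ring.
by have -> : b i0 + L - t = b i0 - (t - L) by ring.
Qed.

(** With F an antiderivative of the factor along the axis i0, the function
    F(t) - F(t - L) has compact support, being 0 on the left and the difference of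
    two equal constants on the right; its derivative is the factor minus its
    translate. *)
Lemma test_derivative_slide a b q k (L : R) : 0 <= L ->
  exists phi : X -> R,
    [/\ test_function phi, measurable_fun [set: X] phi &
      forall z, 'D_(dir_x i0) (phi : X -> R^o) z =
        box_bump a b q k z - box_bump (slide a L) (slide b L) q k z].
Proof.
move=> L0; pose f := bell (a i0) (b i0) k.
have fc : continuous (f : R -> R) by exact: (smooth_bell (a i0) (b i0) k 0%N).
have [F [dF F_le [c F_ge]]] := compact_support_antiderivative fc (fun t => @bell_out R _ _ k t).
pose G (t : R^o) : R^o := F t - F (t - L).
have smoothF : smooth (F : R^o -> R^o).
  case=> [|n]; last exact: CnS1 dF (smooth_bell _ _ _ _).
  exact: Cn_continuous (CnS1 dF (smooth_bell (a i0) (b i0) k 0%N)).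
have dG (t : R^o) : is_derive t (1 : R^o) G (f t - f (t - L)).
  apply: is_deriveB; rewrite -[f (t - L)]mulr1.
  apply: (@is_derive_comp R R^o F (f (t - L)) (fun s => s - L) 1 t 1 (dF _)).
  by rewrite -[X in is_derive _ _ _ X]subr0; apply: is_deriveB.
have smoothG : smooth G.
  have shiftn n : Cn n (fun t : R^o => t - L : R^o).
    by apply: Cn_add; [exact: smooth_id|exact: Cn_cst].
  move=> n; apply: Cn_add => //; under eq_fun do rewrite -mulN1r.
  apply: Cn_mul; first exact: Cn_cst.
  exact: Cn_comp.
have smooth_fam i : smooth (update G (fun i => bell (a i) (b i) k) i).
  by rewrite /update; case: ifP => _; [exact: smoothG|exact: smooth_bell].
exists (tensor (update G (fun i => bell (a i) (b i) k)) (fun j => periodic_cutoff (q j) k)).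
split.
- apply: (@test_function_tensor _ _ _ a (slide b L)) => [//|j|i t|j t].
  + exact: smooth_periodic_cutoff.
  + rewrite /update /slide; case: eqP => [->|_]; last exact: bell_out.
    rewrite negb_and -!leNgt /G => /orP[ta|bt].
      by rewrite !F_le ?subrr// lerBlDr ler_wpDr.
    by rewrite !F_ge ?subrr// ?lerBrDr// (le_trans _ bt)// lerDl.
  + exact: periodic_cutoff_periodic.
- by apply: measurable_tensor => // j; exact: smooth_periodic_cutoff.
- move=> z; have [_ ->] := is_derive_tensor_update (fun i => bell (a i) (b i) k)
    (fun j => periodic_cutoff (q j) k) z dG.
  by rewrite box_bump_update box_bump_slide !tensor_update mulrBl.
Qed.

End constant_along_axis.

Section escaping_strips.
Context {R : realType} {d m : nat}.
Local Notation X := ('rV[R]_d * 'rV[R]_m)%type.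
Local Notation cyl := (@cyl_measure R d m).
Variable i0 : 'I_d.
Implicit Types (a b : 'I_d -> R) (q : 'I_m -> R) (u : X -> R).

Lemma cyl_measure_slide a b L :
  cyl (strip (slide i0 a L) (slide i0 b L)) = cyl (strip a b).
Proof.
rewrite !cyl_measure_strip; congr (_ * _)%E; apply: eq_bigr => i _.
rewrite !lebesgue_measure_itv/= /slide; case: eqP => // _.
by rewrite !lte_fin ltrD2r -!EFinB opprD addrACA subrr addr0.
Qed.

(** Young's inequality with a free parameter e. The first term becomes small
    because the strip escapes, the second because e is small. *)
Let norm_mul_box_bump_young u a b q k (e : R) z : 0 < e ->
  `|u z * box_bump a b q k z| <=
  e^-1 * ((u z) ^+ 2 * \1_(strip a b) z) + e * \1_(strip a b) z.
Proof.
move=> e0; have := box_bump_strip a b q k z; have /andP[c0 c1] := box_bump01 a b q k z.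
rewrite normrM (ger0_norm c0); move: c0 c1; set c : R := box_bump _ _ _ _ _.
have w2 : (u z) ^+ 2 = `|u z| ^+ 2 by rewrite real_normK ?num_real.
rewrite w2 indicE; case: (z \in _) => /= c0 c1 cS; last first.
  have -> : c = 0 by apply/eqP; rewrite eq_le c0 andbT.
  by rewrite !mulr0 addr0.
rewrite !mulr1; apply: le_trans (_ : `|u z| <= _); first by rewrite ler_piMr.
rewrite -(ler_pM2l e0) mulrDr mulVKf ?gt_eqF//.
have := sqr_ge0 (`|u z| - e); have := normr_ge0 (u z); nra.
Qed.

(** Each point leaves the translated strips eventually, and u^2 dominates. *)
Lemma cvg_integral_slide u a b : sq_integrable u ->
  \int[cyl]_z ((u z) ^+ 2 * \1_(strip (slide i0 a n%:R) (slide i0 b n%:R)) z)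
    @[n --> \oo] --> 0.
Proof.
move=> u2; have mu := u2.1.
pose S n : set X := strip (slide i0 a n%:R) (slide i0 b n%:R).
have mS n : measurable (S n) by exact: measurable_strip.
pose f n (z : X) : \bar R := ((u z) ^+ 2 * \1_(S n) z)%:E.
have mf n : measurable_fun setT (f n).
  apply/measurable_EFinP; apply: measurable_funM; first exact: measurable_funX.
  exact: measurable_indic.
have f0 : {ae cyl, forall z, setT z -> f ^~ z @ \oo --> cst 0%E z}.
  apply: nearW => z _; apply: cvg_near_cst.
  exists (Num.bound `|z.1 ord0 i0 - a i0|) => // n /= ln.
  rewrite /f indicE (_ : z \in S n = false) ?mulr0//.
  apply/negbTE; rewrite notin_setE => -[/(_ i0)].
  rewrite /= in_itv/= /slide eqxx => /andP[+ _] _; apply/negP.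
  rewrite -leNgt -lerBlDl (le_trans (ler_norm _))//.
  by rewrite (le_trans (ltW (archi_boundP (normr_ge0 _))))// ler_nat.
have bnd : {ae cyl, forall z n, setT z -> (`|f n z| <= ((u z) ^+ 2)%:E)%E}.
  apply: nearW => z n _; rewrite lee_fin ger0_norm; last first.
    by rewrite mulr_ge0// sqr_ge0.
  by rewrite ler_piMr ?sqr_ge0// indicE; case: (_ \in _).
have [_ _] := dominated_convergence measurableT mf (measurable_cst _) f0
  (integrable_sq u2) bnd.
by rewrite integral0 => /fine_cvgP[].
Qed.

(** The integral I of u against a bump equals that against each translate, so
    |I| is at most e^-1 J n + e M, where J n is the integral of u^2 over the n-th
    translated strip and M the measure of a strip. Since J n tends to 0, this
    forces I = 0. *)
Lemma constant_axis_eq0 u : sq_integrable u ->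
  (forall phi : X -> R, test_function phi -> measurable_fun [set: X] phi ->
    \int[cyl]_z (u z * 'D_(dir_x i0) (phi : X -> R^o) z) = 0) ->
  {ae cyl, forall z, u z = 0}.
Proof.
move=> u2 u_const; apply: orthogonal_box_bump_eq0 => // a b q k.
pose I := \int[cyl]_z (u z * box_bump a b q k z).
have I_slide (n : nat) :
    I = \int[cyl]_z (u z * box_bump (slide i0 a n%:R) (slide i0 b n%:R) q k z).
  have [phi [tphi mphi dphi]] := test_derivative_slide i0 a b q k (ler0n R n).
  apply/eqP; rewrite -subr_eq0 -RintegralB//; try exact: integrable_mul_box_bump.
  rewrite -(u_const phi tphi mphi); apply/eqP; apply: eq_Rintegral => z _.
  by rewrite dphi mulrBr.
have mu_fin : cyl (strip a b) \is a fin_num.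
  by rewrite ge0_fin_numE// cyl_measure_strip_lty.
pose M := fine (cyl (strip a b)).
pose J n := \int[cyl]_z ((u z) ^+ 2 * \1_(strip (slide i0 a n%:R) (slide i0 b n%:R)) z).
have I_le (e : R) (n : nat) : 0 < e -> `|I| <= e^-1 * J n + e * M.
  move=> e0; rewrite (I_slide n).
  pose S : set X := strip (slide i0 a n%:R) (slide i0 b n%:R).
  have mS : measurable S by exact: measurable_strip.
  have uS_int : cyl.-integrable setT (fun z => ((u z) ^+ 2 * \1_S z)%:E).
    apply: le_integrable (integrable_sq u2) => //.
      apply/measurable_EFinP; apply: measurable_funM.
        by apply: measurable_funX; case: u2.
      exact: measurable_indic.
    move=> z _ /=; rewrite lee_fin normrM ler_piMr// indicE.
    by case: (_ \in _); rewrite ?normr1 ?normr0.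
  apply: (le_trans (le_normr_Rintegral measurableT _)).
    exact: integrable_mul_box_bump.
  have -> : e * M = \int[cyl]_z (e * \1_S z).
    rewrite RintegralZl//; last exact: integrable_strip.
    congr (_ * _); rewrite /M /Rintegral integral_indic// setIT.
    by congr fine; exact/esym/cyl_measure_slide.
  rewrite -RintegralZl// -RintegralD//; last 2 first.
  - exact: (integrableZl measurableT e^-1 uS_int).
  - exact: (integrableZl measurableT e (integrable_strip _ _)).
  apply: le_Rintegral => //.
  - exact: (integrable_abse (integrable_mul_box_bump
      (slide i0 a n%:R) (slide i0 b n%:R) q k u2)).
  - exact: (integrableD measurableT (integrableZl measurableT e^-1 uS_int)
      (integrableZl measurableT e (integrable_strip _ _))).
  - by move=> z _; exact: norm_mul_box_bump_young.
have M0 : 0 <= M by rewrite fine_ge0.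
apply/eqP; rewrite -/I -normr_le0 leNgt; apply/negP => I0.
(* With this e, both terms of the bound end up below half of |I|. *)
pose e := `|I| / (2 * (M + 1)).
have e0 : 0 < e by rewrite divr_gt0// mulr_gt0// ltr_wpDl.
have half : 0 < e * (`|I| / 2) by rewrite mulr_gt0// divr_gt0.
have /cvgrPdist_lt/(_ _ half)[n _ /(_ n (leqnn n))] := cvg_integral_slide a b u2.
rewrite sub0r normrN => Jn; have {}Jn := le_lt_trans (ler_norm _) Jn.
have := I_le e n e0; apply/negP; rewrite -ltNge.
have : e^-1 * J n < `|I| / 2 by rewrite mulrC ltr_pdivrMr// mulrC.
have : e * M < `|I| / 2.
  rewrite /e mulrAC -mulrA ltr_pM2l// ltr_pdivrMr ?mulr_gt0// ?ltr_wpDl//.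
  lra.
lra.
Qed.

End escaping_strips.

(** * Norms and weak derivatives of complex-valued functions *)

Section complex_valued.
Context {R : realType} {d m : nat}.
Local Notation X := ('rV[R]_d * 'rV[R]_m)%type.
Local Notation C := R[i].
Local Notation cyl := (@cyl_measure R d m).
Local Notation normc := (@Normc.normc R).
Implicit Types (u v w : X -> C) (phi : X -> R).

Lemma normc_ge0 (x : C) : 0 <= normc x.
Proof. by case: x => a b /=; rewrite sqrtr_ge0. Qed.

Lemma normc_sqr (x : C) : normc x ^+ 2 = complex.Re x ^+ 2 + complex.Im x ^+ 2.
Proof. by case: x => a b /=; rewrite sqr_sqrtr// addr_ge0// sqr_ge0. Qed.

Definition power_integral (p : R) u : \bar R := (\int[cyl]_z (normc (u z) `^ p)%:E)%E.

Lemma enorm_power p u : p != 0 -> (enorm_ p u `^ p)%E = power_integral p u.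
Proof.
move=> p0; rewrite /enorm_ poweR_Lnorm//; apply: eq_integral => z _ /=.
by rewrite ger0_norm ?normc_ge0.
Qed.

(** Holds even when the norm is infinite, both sides being then 0. *)
Lemma norm_power p u : p != 0 -> norm_ p u `^ p = fine (power_integral p u).
Proof. by move=> p0; rewrite -enorm_power// fine_poweR. Qed.

Lemma norm_ge0 p u : 0 <= norm_ p u.
Proof. by rewrite fine_ge0// Lnorm_ge0. Qed.

Lemma norm2_sqr u : norm_ 2 u ^+ 2 = fine (power_integral 2 u).
Proof. by rewrite -norm_power// powR_mulrn// norm_ge0. Qed.

Lemma enorm_lty p u : p != 0 -> (enorm_ p u < +oo)%E = (power_integral p u < +oo)%E.
Proof.
move=> p0; rewrite -enorm_power//; apply/idP/idP; first exact: poweR_lty.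
exact: lty_poweRy.
Qed.

Lemma power_integral2 u :
  power_integral 2 u = (\int[cyl]_z (complex.Re (u z) ^+ 2 + complex.Im (u z) ^+ 2)%:E)%E.
Proof.
apply: eq_integral => z _; rewrite -normc_sqr powR_mulrn//.
exact: normc_ge0.
Qed.

Lemma L2_measurable_normc u : L2 u -> measurable_fun [set: X] (normc \o u).
Proof.
move=> [_ mr mi _].
rewrite (_ : _ \o _ = (fun z => Num.sqrt (complex.Re (u z) ^+ 2 + complex.Im (u z) ^+ 2))).
  apply: (measurableT_comp (continuous_measurable_fun (@sqrt_continuous R))).
  by apply: measurable_funD; exact: measurable_funX.
by apply/funext => z /=; case: (u z).
Qed.

Lemma L2_sq_integrable u : L2 u ->
  sq_integrable (fun z => complex.Re (u z)) /\
  sq_integrable (fun z => complex.Im (u z)).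
Proof.
move=> [_ mr mi]; rewrite enorm_lty// power_integral2 => u2.
have mre : measurable_fun [set: X] (fun z => (complex.Re (u z) ^+ 2)%:E).
  by apply/measurable_EFinP; exact: measurable_funX.
have mim : measurable_fun [set: X] (fun z => (complex.Im (u z) ^+ 2)%:E).
  by apply/measurable_EFinP; exact: measurable_funX.
have mre2 : measurable_fun [set: X] (fun z => (complex.Re (u z) ^+ 2 + complex.Im (u z) ^+ 2)%:E).
  by apply/measurable_EFinP; apply: measurable_funD; exact: measurable_funX.
split; split=> //; apply: le_lt_trans u2; apply: ge0_le_integral => //= z _.
- by rewrite lee_fin sqr_ge0.
- by rewrite lee_fin lerDl sqr_ge0.
- by rewrite lee_fin sqr_ge0.
- by rewrite lee_fin lerDr sqr_ge0.
Qed.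

Lemma L2_norm0_ae u : L2 u -> norm_ 2 u = 0 -> {ae cyl, forall z, u z = 0}.
Proof.
move=> uL2 /eqP; rewrite fine_eq0 => [/eqP u0|]; last first.
  by case: uL2 => _ _ _ u2; rewrite ge0_fin_numE// Lnorm_ge0.
have mu : measurable_fun [set: X] (EFin \o (normc \o u)).
  by apply/measurable_EFinP; exact: L2_measurable_normc.
have := Lnorm_eq0_eq0 mu (_ : (0 < 2%:E)%E) u0.
rewrite lte_fin ltr0n => /(_ isT); apply: filterS => z /(_ I) /= [].
exact: Normc.eq0_normc.
Qed.

Lemma measurable_power_integrand p u : L2 u ->
  measurable_fun [set: X] (fun z => (normc (u z) `^ p)%:E).
Proof.
move=> uL2; apply/measurable_EFinP.
exact: (measurableT_comp (measurable_powR p) (L2_measurable_normc uL2)).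
Qed.

Lemma ae_eq_norm2 u v : L2 u -> L2 v -> {ae cyl, forall z, u z = v z} ->
  norm_ 2 u ^+ 2 = norm_ 2 v ^+ 2.
Proof.
move=> uL2 vL2 uv; rewrite !norm2_sqr; congr fine.
apply: ge0_ae_eq_integral => //.
- exact: measurable_power_integrand.
- exact: measurable_power_integrand.
- by move=> z _; rewrite lee_fin powR_ge0.
- by move=> z _; rewrite lee_fin powR_ge0.
- by apply: filterS uv => z uvz _ /=; rewrite uvz.
Qed.

Lemma mulrCr (x : C) (r : R) : x * r%:C%C = Complex (complex.Re x * r) (complex.Im x * r).
Proof. by case: x => a b; apply/eqP; rewrite eq_complex /= !mulr0 subr0 add0r !eqxx. Qed.

Lemma cintegral_mulr u phi : cintegral (fun z => u z * (phi z)%:C%C) =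
  Complex (\int[cyl]_z (complex.Re (u z) * phi z)) (\int[cyl]_z (complex.Im (u z) * phi z)).
Proof.
rewrite /cintegral; congr Complex; apply: eq_Rintegral => z _; by rewrite mulrCr.
Qed.

Lemma sq_integrableB (f g : X -> R) : sq_integrable f -> sq_integrable g ->
  sq_integrable (fun z => f z - g z).
Proof.
move=> f2 g2; have [mf _] := f2; have [mg _] := g2.
split; first exact: measurable_funB.
have /integrableP[_ fg] : cyl.-integrable setT
    (fun z => (2 * f z ^+ 2)%:E + (2 * g z ^+ 2)%:E)%E.
  exact: (integrableD measurableT (integrableZl measurableT 2 (integrable_sq f2))
    (integrableZl measurableT 2 (integrable_sq g2))).
apply: le_lt_trans fg; apply: ge0_le_integral => //=.
- by move=> z _; rewrite lee_fin sqr_ge0.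
- by apply/measurable_EFinP; apply: measurable_funX; exact: measurable_funB.
- apply/measurable_EFinP; apply: measurableT_comp => //; apply: measurable_funD;
  by apply: measurable_funM => //; exact: measurable_funX.
- move=> z _; rewrite lee_fin; apply: le_trans (ler_norm _).
  by have := sqr_ge0 (f z + g z); nra.
Qed.

(** Two weak derivatives have the same integral against every bump, separately
    for real and imaginary parts. *)
Lemma weak_derivative_unique e u v w :
  v \in L2_derivatives e u -> w \in L2_derivatives e u ->
  {ae cyl, forall z, v z = w z}.
Proof.
rewrite !inE => -[vL2 uv] [wL2 uw].
have [vr vi] := L2_sq_integrable vL2; have [wr wi] := L2_sq_integrable wL2.
have eq_box_bump a b q k : cintegral (fun z => v z * (box_bump a b q k z)%:C%C) =
    cintegral (fun z => w z * (box_bump a b q k z)%:C%C).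
  apply: oppr_inj; rewrite -(uv _ (test_function_box_bump a b q k)).
  by rewrite -(uw _ (test_function_box_bump a b q k)).
have re0 : {ae cyl, forall z, complex.Re (v z) - complex.Re (w z) = 0}.
  apply: (orthogonal_box_bump_eq0 (sq_integrableB vr wr)) => a b q k.
  under eq_Rintegral do rewrite mulrBl.
  rewrite RintegralB//; try exact: integrable_mul_box_bump.
  by have := eq_box_bump a b q k; rewrite !cintegral_mulr => -[/= -> _]; rewrite subrr.
have im0 : {ae cyl, forall z, complex.Im (v z) - complex.Im (w z) = 0}.
  apply: (orthogonal_box_bump_eq0 (sq_integrableB vi wi)) => a b q k.
  under eq_Rintegral do rewrite mulrBl.
  rewrite RintegralB//; try exact: integrable_mul_box_bump.
  by have := eq_box_bump a b q k; rewrite !cintegral_mulr => -[/= _ ->]; rewrite subrr.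
apply: filterS2 re0 im0 => z /eqP; rewrite subr_eq0 => /eqP re /eqP.
rewrite subr_eq0 => /eqP im; apply/eqP; rewrite eq_complex re im !eqxx.
by [].
Qed.

End complex_valued.

Section weak_gradient.
Context {R : realType} {d m : nat}.
Local Notation X := ('rV[R]_d * 'rV[R]_m)%type.
Local Notation C := R[i].
Local Notation cyl := (@cyl_measure R d m).
Implicit Types (u v w : X -> C) (phi : X -> R).

Lemma weak_derivative_x u i : H1 u ->
  L2_derivatives (dir_x i) u (weak_derivative (dir_x i) u).
Proof. by move=> [_ /(_ i) [w uw] _]; apply: xgetPex; exists w. Qed.

Lemma weak_derivative_y u j : H1 u ->
  L2_derivatives (dir_y j) u (weak_derivative (dir_y j) u).
Proof. by move=> [_ _ /(_ j) [w uw]]; apply: xgetPex; exists w. Qed.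

(** The gradient norms may be computed with any weak derivative. *)
Lemma weak_derivative_norm e u w : L2_derivatives e u w ->
  norm_ 2 (weak_derivative e u) ^+ 2 = norm_ 2 w ^+ 2.
Proof.
move=> uw; have uw' : L2_derivatives e u (weak_derivative e u).
  by apply: xgetPex; exists w.
apply: ae_eq_norm2; [by case: uw'|by case: uw|].
by apply: (@weak_derivative_unique _ _ _ e u); rewrite inE.
Qed.

Lemma ae_eq0_cintegral w phi : L2 w -> measurable_fun [set: X] phi ->
  {ae cyl, forall z, w z = 0} -> cintegral (fun z => w z * (phi z)%:C%C) = 0.
Proof.
move=> [_ mr mi _] mphi w0.
have int0 (f : X -> R) : measurable_fun [set: X] f -> {ae cyl, forall z, f z = 0} ->
    \int[cyl]_z (f z * phi z) = 0.
  move=> mf f0; rewrite /Rintegral (@ae_eq_integral _ _ _ cyl setT (cst 0%E)) ?integral0//.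
  - by apply/measurable_EFinP; exact: measurable_funM.
  - by apply: filterS f0 => z fz _; rewrite fz mul0r.
rewrite cintegral_mulr !int0//.
- by apply: filterS w0 => z ->.
- by apply: filterS w0 => z ->.
Qed.

Lemma grad_x_sqnorm_ge0 u : 0 <= grad_x_sqnorm u.
Proof. by apply: sumr_ge0 => i _; exact: sqr_ge0. Qed.

Lemma grad_y_sqnorm_ge0 u : 0 <= grad_y_sqnorm u.
Proof. by apply: sumr_ge0 => i _; exact: sqr_ge0. Qed.

(** A vanishing x-gradient would make u constant, hence zero, along the first
    axis. *)
Lemma grad_x_sqnorm_gt0 u : (0 < d)%N -> H1 u ->
  ~ {ae cyl, forall z, u z = 0} -> 0 < grad_x_sqnorm u.
Proof.
move=> d0 uH1 u_n0; rewrite lt_def grad_x_sqnorm_ge0 andbT; apply/negP => /eqP g0.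
apply: u_n0; pose i0 := Ordinal d0; have [uL2 _ _] := uH1.
have [wL2 uw] := weak_derivative_x i0 uH1.
set w := weak_derivative (dir_x i0) u in wL2 uw.
have w0 : {ae cyl, forall z, w z = 0}.
  apply: L2_norm0_ae => //; apply/eqP; rewrite -sqrf_eq0; apply/eqP.
  by apply: (psumr_eq0P _ g0) => // i _; exact: sqr_ge0.
have u_axis phi : test_function phi -> measurable_fun [set: X] phi ->
    \int[cyl]_z (complex.Re (u z) * 'D_(dir_x i0) (phi : X -> R^o) z) = 0 /\
    \int[cyl]_z (complex.Im (u z) * 'D_(dir_x i0) (phi : X -> R^o) z) = 0.
  move=> tphi mphi; have := uw phi tphi.
  by rewrite (ae_eq0_cintegral wL2 mphi w0) oppr0 cintegral_mulr => -[].
have [u_re u_im] := L2_sq_integrable uL2.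
have re0 := constant_axis_eq0 u_re (fun phi tphi mphi => (u_axis phi tphi mphi).1).
have im0 := constant_axis_eq0 u_im (fun phi tphi mphi => (u_axis phi tphi mphi).2).
apply: filterS2 re0 im0 => z re im; apply/eqP; rewrite eq_complex re im.
by rewrite /= !eqxx.
Qed.

End weak_gradient.

(** * Rescaling *)

Section rescaling.
Context {R : realType} {d m : nat}.
Local Notation X := ('rV[R]_d * 'rV[R]_m)%type.
Local Notation C := R[i].
Local Notation cyl := (@cyl_measure R d m).
Implicit Types (u v w : X -> C) (phi : X -> R).

Definition rescale (s b : R) u (z : X) : C := s%:C%C * u (dilate b z).

Variables (s b : R).
Hypotheses (s0 : 0 < s) (b0 : 0 < b).

Let bn0 : b != 0. Proof. by rewrite gt_eqF. Qed.

Lemma dilateVK : cancel (dilate b^-1) (@dilate R d m b).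
Proof. by move=> z; rewrite -{1}(invrK b) dilateK// invr_eq0. Qed.

Lemma integral_dilate (h : X -> \bar R) :
  (\int[cyl]_z h (dilate b z) = (b ^+ d)^-1%:E * \int[cyl]_z h z)%E.
Proof.
apply: (@integral_comp_bij _ _ _ cyl (dilate b) (dilate b^-1)).
- exact: measurable_dilate.
- exact: measurable_dilate.
- exact: dilateK.
- exact: dilateVK.
- by rewrite invr_gt0 exprn_gt0.
- by move=> A mA; exact: cyl_measure_dilate.
Qed.

Lemma Rintegral_dilate (h : X -> R) :
  \int[cyl]_z h (dilate b z) = (b ^+ d)^-1 * \int[cyl]_z h z.
Proof.
rewrite /Rintegral (integral_dilate (EFin \o h)).
have k0 : 0 < (b ^+ d)^-1 by rewrite invr_gt0 exprn_gt0.
case: (integral _ _ _) => [x| |]//=.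
- by rewrite gt0_muley ?lte_fin//= mulr0.
- by rewrite gt0_muleNy ?lte_fin//= mulr0.
Qed.

Lemma cintegral_dilate (f : X -> C) :
  cintegral (fun z => f (dilate b z)) = ((b ^+ d)^-1)%:C%C * cintegral f.
Proof.
rewrite /cintegral (Rintegral_dilate (fun z => complex.Re (f z))).
rewrite (Rintegral_dilate (fun z => complex.Im (f z))).
by rewrite [RHS]mulrC mulrCr /=; congr Complex; rewrite mulrC.
Qed.

Lemma power_integral_rescale p u : L2 u ->
  power_integral p (rescale s b u) = ((s `^ p * (b ^+ d)^-1)%:E * power_integral p u)%E.
Proof.
move=> uL2; rewrite /power_integral EFinM -muleA.
rewrite -(integral_dilate (fun z => (Normc.normc (u z) `^ p)%:E)).
rewrite -ge0_integralZl//; last 3 first.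
- apply: (measurableT_comp (measurable_power_integrand p uL2)).
  exact: measurable_dilate.
- by move=> z _; rewrite lee_fin powR_ge0.
- by rewrite lee_fin powR_ge0.
apply: eq_integral => z _; rewrite /rescale Normc.normcM powRM ?normc_ge0//.
by rewrite /= expr0n/= addr0 sqrtr_sqr gtr0_norm.
Qed.

Lemma norm_power_rescale p u : p != 0 -> L2 u ->
  norm_ p (rescale s b u) `^ p = s `^ p * (b ^+ d)^-1 * norm_ p u `^ p.
Proof.
move=> p0 uL2; rewrite !norm_power// power_integral_rescale//.
have k0 : 0 < s `^ p * (b ^+ d)^-1.
  by rewrite mulr_gt0 ?powR_gt0// invr_gt0 exprn_gt0.
case: (power_integral p u) => [x| |]//=.
- by rewrite gt0_muley ?lte_fin//= mulr0.
- by rewrite gt0_muleNy ?lte_fin//= mulr0.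
Qed.

Lemma norm2_sqr_rescale u : L2 u ->
  norm_ 2 (rescale s b u) ^+ 2 = s ^+ 2 * (b ^+ d)^-1 * norm_ 2 u ^+ 2.
Proof.
move=> uL2; rewrite -!(powR_mulrn 2) ?norm_ge0 ?ltW//.
exact: norm_power_rescale.
Qed.

Lemma L2_rescale u : L2 u -> L2 (rescale s b u).
Proof.
move=> uL2; have [uper mr mi u2] := uL2; split.
- by move=> x y j; rewrite /rescale /dilate /= uper.
- rewrite /rescale; under eq_fun do rewrite mulrC mulrCr /=.
  apply: measurable_funM => //; exact: (measurableT_comp mr (measurable_dilate _)).
- rewrite /rescale; under eq_fun do rewrite mulrC mulrCr /=.
  apply: measurable_funM => //; exact: (measurableT_comp mi (measurable_dilate _)).
- rewrite enorm_lty// power_integral_rescale//; move: u2; rewrite enorm_lty// => u2.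
  by rewrite lte_mul_pinfty// lee_fin mulr_ge0 ?powR_ge0// invr_ge0 exprn_ge0// ltW.
Qed.

Lemma rescale_ae_eq0 u : {ae cyl, forall z, rescale s b u z = 0} ->
  {ae cyl, forall z, u z = 0}.
Proof.
move=> [N [mN N0 uN]]; exists (dilate b^-1 @^-1` N); split.
- by rewrite -[X in measurable X]setTI; exact: measurable_dilate.
- by rewrite cyl_measure_dilate ?invr_gt0// N0 mule0.
- have sC : s%:C%C != 0 :> C by rewrite eq_complex /= gt_eqF.
  move=> z uz; apply: (uN (dilate b^-1 z)) => /= /eqP; rewrite /rescale dilateVK mulf_eq0.
  by rewrite (negbTE sC) => /eqP.
Qed.

Lemma dilate_linear (c : R) (h : R) (v z : X) :
  dilate c (h *: v + z) = h *: dilate c v + dilate c z.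
Proof.
case: v z => [v1 v2] [z1 z2]; congr pair => /=.
by rewrite scalerDr !scalerA mulrC.
Qed.

Lemma continuous_dilate (c : R) : continuous (@dilate R d m c).
Proof.
move=> z; have c1 : (fun w : X => c *: w.1) @ z --> c *: z.1.
  exact: (continuous_comp cvg_fst (@scaler_continuous _ _ c z.1)).
have c2 : (fun w : X => w.2) @ z --> z.2 by exact: cvg_snd.
exact: (cvg_pair c1 c2).
Qed.

(** The factor r lets the scalars produced by rescaling be absorbed into the
    test function, so that they never have to be pulled out of an integral whose
    integrand might fail to be measurable. *)
Lemma test_function_dilate (r : R) phi : test_function phi ->
  test_function (fun z => r * phi (dilate b^-1 z)).
Proof.
move=> [phis phiper [t phi0]]; split.
- move=> n; apply: Cn_mul; first exact: Cn_cst.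
  exact: (@Cn_affine R X X _ _ (dilate_linear b^-1) n phi (@continuous_dilate b^-1) (phis n)).
- by move=> x y j; rewrite /dilate /= phiper.
- exists (b * t) => x y xt; rewrite /dilate /= phi0 ?mulr0//.
  by rewrite normrZ gtr0_norm ?invr_gt0// ltr_pdivlMl.
Qed.

End rescaling.

Section rescaled_sobolev.
Context {R : realType} {d m : nat}.
Local Notation X := ('rV[R]_d * 'rV[R]_m)%type.
Local Notation C := R[i].
Implicit Types (u v w : X -> C) (phi : X -> R).
Variables (s b : R).
Hypotheses (s0 : 0 < s) (b0 : 0 < b).

(** The test function phi for the rescaled function corresponds to
    psi = s c phi o dilate b^-1 for u: differentiating psi along e gives the factor
    c^-1, so u against the derivative of psi, taken at the dilated point, is the
    rescaled function against the derivative of phi. *)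
Lemma rescale_derivative e (c : R) u w : 0 < c -> dilate b e = c *: e ->
  L2_derivatives e u w -> L2_derivatives e (rescale s b u) (rescale (s * c) b w).
Proof.
move=> c0 be [wL2 uw]; split; first by apply: L2_rescale => //; rewrite mulr_gt0.
move=> phi tphi.
have tpsi := test_function_dilate b0 (s * c) tphi.
set psi : X -> R := (fun z => _) in tpsi.
have Ve : dilate b^-1 e = c^-1 *: e.
  apply: (can_inj (dilateK (lt0r_neq0 b0))); rewrite (dilateVK b0) -[c^-1 *: e]addr0.
  by rewrite dilate_linear be scalerA mulVf ?gt_eqF// scale1r /dilate /= scaler0 addr0.
have dpsi z : 'D_e (psi : X -> R^o) (dilate b z) = s * 'D_e (phi : X -> R^o) z.
  have [phis _ _] := tphi.
  have phi1 := phis 1%N.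
  have phiV : Cn 1 ((phi : X -> R^o) \o dilate b^-1).
    exact: (@Cn_affine R X X _ _ (dilate_linear b^-1) 1%N phi (@continuous_dilate R d m b^-1) phi1).
  rewrite deriveMl; last by case: (Cn_is_derive e (dilate b z) phiV).
  rewrite (derive_affine (dilate_linear b^-1)) Ve dilateK ?gt_eqF//.
  by rewrite (derive_direction _ _ _ phi1) mulrA mulfK// gt_eqF.
pose f z := u z * ('D_e (psi : X -> R^o) z)%:C%C.
pose g z := w z * (psi z)%:C%C.
transitivity (cintegral (fun z => f (dilate b z))).
  congr cintegral; apply/funext => z; rewrite /f dpsi /rescale rmorphM.
  by rewrite mulrCA mulrA.
rewrite (cintegral_dilate b0 f) (uw _ tpsi) mulrN -(cintegral_dilate b0 g).
congr (- cintegral _); apply/funext => z.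
rewrite /g /psi dilateK ?gt_eqF// /rescale rmorphM.
by rewrite mulrCA mulrA.
Qed.

Let dilate_dir_x i : @dilate R d m b (dir_x i) = b *: dir_x i.
Proof. by congr pair; rewrite scaler0. Qed.

Let dilate_dir_y j : @dilate R d m b (dir_y j) = 1 *: dir_y j.
Proof. by rewrite scale1r; congr pair; rewrite scaler0. Qed.

Lemma H1_rescale u : H1 u -> H1 (rescale s b u).
Proof.
move=> uH1; have [uL2 _ _] := uH1; split; first exact: L2_rescale.
- move=> i; exists (rescale (s * b) b (weak_derivative (dir_x i) u)).
  exact: (rescale_derivative b0 (dilate_dir_x i) (weak_derivative_x i uH1)).
- move=> j; exists (rescale (s * 1) b (weak_derivative (dir_y j) u)).
  exact: (rescale_derivative ltr01 (dilate_dir_y j) (weak_derivative_y j uH1)).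
Qed.

Lemma grad_x_sqnorm_rescale u : H1 u ->
  grad_x_sqnorm (rescale s b u) = s ^+ 2 * (b ^+ d)^-1 * (b ^+ 2 * grad_x_sqnorm u).
Proof.
move=> uH1; rewrite /grad_x_sqnorm !mulr_sumr; apply: eq_bigr => i _.
have ui := weak_derivative_x i uH1.
rewrite (weak_derivative_norm (rescale_derivative b0 (dilate_dir_x i) ui)).
rewrite norm2_sqr_rescale ?mulr_gt0//; last by case: ui.
by ring.
Qed.

Lemma grad_y_sqnorm_rescale u : H1 u ->
  grad_y_sqnorm (rescale s b u) = s ^+ 2 * (b ^+ d)^-1 * grad_y_sqnorm u.
Proof.
move=> uH1; rewrite /grad_y_sqnorm !mulr_sumr; apply: eq_bigr => j _.
have uj := weak_derivative_y j uH1.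
rewrite (weak_derivative_norm (rescale_derivative ltr01 (dilate_dir_y j) uj)).
by rewrite mulr1 norm2_sqr_rescale//; case: uj.
Qed.

Lemma mass_rescale u : H1 u ->
  mass (rescale s b u) = s ^+ 2 * (b ^+ d)^-1 * mass u.
Proof. by move=> [uL2 _ _]; exact: norm2_sqr_rescale. Qed.

Lemma potential_rescale alpha u : 0 < alpha -> H1 u ->
  potential alpha (rescale s b u) =
  s ^+ 2 * (b ^+ d)^-1 * (s `^ alpha * potential alpha u).
Proof.
move=> alpha0 [uL2 _ _]; have a20 : alpha + 2 != 0 by rewrite gt_eqF// addr_gt0.
rewrite /potential norm_power_rescale// powRD; last by rewrite (gt_eqF s0) implybT.
by rewrite (powR_mulrn 2 (ltW s0)); ring.
Qed.

End rescaled_sobolev.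

(** * The comparison of action levels *)

Section ground_state_levels.
Context {R : realType}.

(** Both logarithms lie below the tangent line of ln at the mean. *)
Lemma ln_concave (w x y : R) : 0 <= w <= 1 -> 0 < x -> 0 < y ->
  w * ln x + (1 - w) * ln y <= ln (w * x + (1 - w) * y).
Proof.
move=> /andP[w0 w1] x0 y0; set M := w * x + (1 - w) * y.
have w1' : 0 <= 1 - w by rewrite subr_ge0.
have M0 : 0 < M.
  have [w00|wn0] := eqVneq w 0; first by rewrite /M w00 mul0r add0r subr0 mul1r.
  have w_gt0 : 0 < w by rewrite lt_def wn0.
  by rewrite ltr_wpDr ?mulr_gt0// mulr_ge0// ltW.
have tangent z : 0 < z -> ln z <= ln M + (z / M - 1).
  move=> z0; rewrite -lerBlDl -ln_div//.
  by rewrite -[X in ln X](subrK 1) addrC le_ln1Dx// ltrBrDl subrr divr_gt0.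
have mean : w * (x / M - 1) + (1 - w) * (y / M - 1) = 0.
  by rewrite /M; field; rewrite gt_eqF.
have hx := ler_wpM2l w0 (tangent _ x0).
have hy := ler_wpM2l w1' (tangent _ y0).
apply: (le_trans (lerD hx hy)).
rewrite (_ : w * (ln M + (x / M - 1)) + (1 - w) * (ln M + (y / M - 1)) =
  ln M + (w * (x / M - 1) + (1 - w) * (y / M - 1))); last by ring.
by rewrite mean addr0.
Qed.

(** Q is the value of b^2 G + A at the point where G has been brought to its
    share c of the sum; b is chosen for that, and then s so that the potential
    matches the sum. *)
Lemma rescaling_parameters (d : nat) (alpha c G A P : R) :
  0 < alpha -> 0 < c < 1 -> 0 < G -> 0 < A -> 0 < P ->
  exists s b Q : R,
    [/\ 0 < s, 0 < b, A = (1 - c) * Q, b ^+ 2 * G = c * Q & s `^ alpha * P = Q] /\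
    ln (s ^+ 2 * (b ^+ d)^-1 * Q) =
      ln Q + 2 / alpha * (ln Q - ln P) - d%:R / 2 * (ln (c * Q) - ln G).
Proof.
move=> alpha0 /andP[c0 c1] G0 A0 P0.
have c1' : 0 < 1 - c by rewrite subr_gt0.
pose Q := A / (1 - c); have Q0 : 0 < Q by rewrite divr_gt0.
have QP0 : 0 < Q / P by rewrite divr_gt0.
have cQ0 : 0 < c * Q by rewrite mulr_gt0.
have bb0 : 0 < c * Q / G by rewrite divr_gt0.
pose s := (Q / P) `^ alpha^-1; pose b : R := Num.sqrt (c * Q / G).
have s0 : 0 < s by rewrite powR_gt0.
have b0 : 0 < b by rewrite sqrtr_gt0.
have b2 : b ^+ 2 = c * Q / G by rewrite sqr_sqrtr// ltW.
exists s, b, Q; split; first split => //.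
- by rewrite /Q mulrC divfK// gt_eqF.
- by rewrite b2 divfK// gt_eqF.
- by rewrite /s -powRrM mulVf ?gt_eqF// powRr1 ?ltW// divfK// gt_eqF.
have lns : ln s = alpha^-1 * (ln Q - ln P) by rewrite ln_powR ln_div.
have lnb : 2 * ln b = ln (c * Q) - ln G.
  have := congr1 (@ln R) b2; rewrite lnXn// ln_div ?posrE// => <-.
  by rewrite mulr_natl.
have s20 : 0 < s ^+ 2 by rewrite exprn_gt0.
have bd0 : 0 < (b ^+ d)^-1 by rewrite invr_gt0 exprn_gt0.
have sb0 : 0 < s ^+ 2 * (b ^+ d)^-1 by rewrite mulr_gt0.
rewrite [LHS](lnM (sb0 : _ \in Num.pos) (Q0 : _ \in Num.pos)).
rewrite (lnM (s20 : _ \in Num.pos) (bd0 : _ \in Num.pos)).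
rewrite lnV ?posrE ?exprn_gt0// !lnXn// lns -lnb.
rewrite -[ln b *+ d]mulr_natl -mulr_natl; field.
by rewrite gt_eqF.
Qed.

(** L is the potential of the doubly constrained rescaling, and its action is
    the left-hand side. With g = ln (G / c), p = ln P and q = ln Q, the formula for
    ln L is q + (2 / alpha) (q - p) - (D / 2) (q - g). In the Nehari case concavity
    gives p >= c g + (1 - c) q, and (1 + 2 / alpha) c = D / 2 yields ln L <= p. In
    the virial case g = p, so ln L is the mean of q and p with weights 1 - l and l
    for l = D / 2 - 2 / alpha, while the action of u is the same multiple of
    (1 - l) Q + l P. *)
Lemma critical_level_le (D alpha c G A P Q L : R) :
  0 < alpha -> 4 <= alpha * D -> c = alpha * D / (2 * (alpha + 2)) -> 0 < c < 1 ->
  0 < G -> 0 < P -> 0 < Q -> 0 < L -> A = (1 - c) * Q ->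
  ln L = ln Q + 2 / alpha * (ln Q - ln P) - D / 2 * (ln (c * Q) - ln G) ->
  G + A = P \/ G = c * P ->
  (2^-1 - (alpha + 2)^-1) * L <= 2^-1 * (G + A) - (alpha + 2)^-1 * P.
Proof.
move=> alpha0 alphaD cE /andP[c0 c1] G0 P0 Q0 L0 AE lnL GAP.
have a2 : 0 < alpha + 2 by rewrite addr_gt0.
have cD : (1 + 2 / alpha) * c = D / 2.
  by rewrite cE; field; rewrite !gt_eqF.
have half0 : 0 <= 2^-1 - (alpha + 2)^-1.
  by rewrite subr_ge0 lef_pV2 ?posrE// lerDr ltW.
have lncQ : ln (c * Q) = ln c + ln Q by rewrite lnM ?posrE.
case: GAP => [GA|GP].
- have LP : L <= P.
    rewrite -ler_ln ?posrE// lnL lncQ.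
    have Gc0 : 0 < G / c by rewrite divr_gt0.
    have c01 : 0 <= c <= 1 by rewrite !ltW.
    have := ln_concave c01 Gc0 Q0.
    rewrite (_ : c * (G / c) + (1 - c) * Q = P); last first.
      by rewrite -GA AE; field; rewrite gt_eqF.
    rewrite ln_div ?posrE// => conc.
    have coef0 : 0 <= 1 + 2 / alpha by rewrite addr_ge0// divr_ge0// ltW.
    have := ler_wpM2l coef0 conc; rewrite -cD; lra.
  rewrite GA -mulrBl; exact: ler_wpM2l.
- pose l := D / 2 - 2 / alpha.
  have l0 : 0 <= l.
    by rewrite /l subr_ge0 ler_pdivrMr// mulrAC ler_pdivlMr//; lra.
  have l1 : l <= 1.
    have : alpha * D < 2 * (alpha + 2).
      by move: c1; rewrite cE ltr_pdivrMr ?mul1r ?mulr_gt0.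
    rewrite /l lerBlDr -(ler_pM2l alpha0).
    by rewrite (_ : alpha * (1 + 2 / alpha) = alpha + 2); [lra|field; rewrite gt_eqF].
  have lnGE : ln G = ln c + ln P by rewrite GP lnM ?posrE.
  have LQ : L <= (1 - l) * Q + l * P.
    have M0 : 0 < (1 - l) * Q + l * P.
      have [l00|ln0] := eqVneq l 0; first by rewrite l00 mul0r addr0 subr0 mul1r.
      have lp : 0 < l by rewrite lt_def ln0.
      by rewrite ltr_wpDl ?mulr_gt0// mulr_ge0 ?subr_ge0// ltW.
    rewrite -ler_ln ?posrE// addrC.
    apply: le_trans (ln_concave (_ : 0 <= l <= 1) P0 Q0); last by rewrite l0.
    by rewrite lnL lncQ lnGE /l; lra.
  apply: le_trans (ler_wpM2l half0 LQ) _.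
  rewrite le_eqVlt; apply/orP; left; apply/eqP.
  rewrite GP AE /l cE; field.
  by rewrite !gt_eqF.
Qed.

End ground_state_levels.

(** * Equality of the two infima *)

Section variational_levels.
Context {R : realType} {d m : nat}.
Local Notation X := ('rV[R]_d * 'rV[R]_m)%type.
Local Notation C := R[i].
Implicit Types (u v : X -> C).
Variables (alpha omega : R).
Hypotheses (d_gt0 : (0 < d)%N) (omega0 : 0 < omega) (alpha0 : 0 < alpha).
Hypothesis mass_critical : 4 <= alpha * d%:R.
Let c := alpha * d%:R / (2 * (alpha + 2)).
Hypothesis energy_subcritical : c < 1.

Let c0 : 0 < c.
Proof. by rewrite /c divr_gt0 ?mulr_gt0 ?ltr0n ?addr_gt0. Qed.

Let transverse u := grad_y_sqnorm u + omega * mass u.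

Let actionE u : action alpha omega u =
  2^-1 * (grad_x_sqnorm u + transverse u) - (alpha + 2)^-1 * potential alpha u.
Proof. by rewrite /action /energy /grad_sqnorm /transverse; lra. Qed.

Let nehariE u : nehari alpha omega u =
  grad_x_sqnorm u + transverse u - potential alpha u.
Proof. by rewrite /nehari /grad_sqnorm /transverse; lra. Qed.

Let virialE u : virial alpha u = grad_x_sqnorm u - c * potential alpha u.
Proof. by []. Qed.

Lemma H1_nonzero_positive u : H1_nonzero u ->
  0 < grad_x_sqnorm u /\ 0 < transverse u.
Proof.
move=> [uH1 u_n0]; split; first exact: grad_x_sqnorm_gt0.
rewrite /transverse ltr_wpDl ?grad_y_sqnorm_ge0// mulr_gt0//.
rewrite /mass lt_def sqr_ge0 andbT sqrf_eq0; apply/negP => /eqP u0.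
by apply: u_n0; apply: L2_norm0_ae => //; case: uH1.
Qed.

(** The constraint forces the potential to be positive, so it is finite as well:
    a potential of infinite integral would be read as 0. *)
Lemma exists_doubly_constrained u : H1_nonzero u ->
  virial alpha u = 0 \/ nehari alpha omega u = 0 ->
  exists v, [/\ H1_nonzero v, virial alpha v = 0, nehari alpha omega v = 0 &
    action alpha omega v <= action alpha omega u].
Proof.
move=> u_n0 u_constr; have [uH1 u_ne] := u_n0.
have [G0 A0] := H1_nonzero_positive u_n0.
have P0 : 0 < potential alpha u.
  case: u_constr => [|].
    by rewrite virialE => /eqP; rewrite subr_eq0 => /eqP GP; rewrite -(pmulr_rgt0 _ c0) -GP.
  by rewrite nehariE => /eqP; rewrite subr_eq0 => /eqP <-; rewrite addr_gt0.
have c01 : 0 < c < 1 by rewrite c0.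
have [s [b [Q [[s0 b0 AE bG sP] lnL]]]] := rescaling_parameters d alpha0 c01 G0 A0 P0.
pose k := s ^+ 2 * (b ^+ d)^-1.
have k0 : 0 < k by rewrite mulr_gt0 ?exprn_gt0// invr_gt0 exprn_gt0.
have Q0 : 0 < Q by rewrite -sP mulr_gt0// powR_gt0.
pose v := rescale s b u.
have vG : grad_x_sqnorm v = k * (c * Q) by rewrite grad_x_sqnorm_rescale// bG.
have vA : transverse v = k * ((1 - c) * Q).
  rewrite /transverse grad_y_sqnorm_rescale// mass_rescale// -AE /transverse /k; ring.
have vP : potential alpha v = k * Q by rewrite potential_rescale// sP.
exists v; split.
- split; first exact: H1_rescale.
  by move=> v0; apply: u_ne; apply: rescale_ae_eq0 v0.
- by rewrite virialE vG vP; ring.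
- by rewrite nehariE vG vA vP; ring.
- rewrite !actionE vG vA vP.
  have := @critical_level_le R d%:R alpha c _ _ _ Q (k * Q) alpha0 mass_critical erefl c01
    G0 P0 Q0 (mulr_gt0 k0 Q0) AE lnL.
  have -> : 2^-1 * (k * (c * Q) + k * ((1 - c) * Q)) - (alpha + 2)^-1 * (k * Q) =
    (2^-1 - (alpha + 2)^-1) * (k * Q) by ring.
  apply; case: u_constr => [|].
    by rewrite virialE => /eqP; rewrite subr_eq0 => /eqP; right.
  by rewrite nehariE => /eqP; rewrite subr_eq0 => /eqP; left.
Qed.

Lemma gamma_inf_eq_beta_inf : gamma_inf d m alpha omega = beta_inf d m alpha omega.
Proof.
apply/eqP; rewrite eq_le; apply/andP; split;
  apply: le_ereal_inf_tmp => _ [u [u_n0 u_constr] <-].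
- have [v [v_n0 v_virial v_nehari vu]] := exists_doubly_constrained u_n0 (or_intror u_constr).
  apply: ge_ereal_inf; exists (action alpha omega v)%:E; last by rewrite lee_fin.
  by exists v.
- have [v [v_n0 v_virial v_nehari vu]] := exists_doubly_constrained u_n0 (or_introl u_constr).
  apply: ge_ereal_inf; exists (action alpha omega v)%:E; last by rewrite lee_fin.
  by exists v.
Qed.

End variational_levels.

(** The compact variables only lower the upper critical exponent, so alpha is
    subcritical for the x-variables alone. *)
Lemma subcritical_exponent (R : realType) (d m : nat) (alpha : R) :
  0 < alpha -> (alpha%:E < upper_critical R d m)%E ->
  alpha * d%:R / (2 * (alpha + 2)) < 1.
Proof.
move=> alpha0 alpha_lt; have a2 : 0 < alpha + 2 by rewrite addr_gt0.
rewrite ltr_pdivrMr ?mulr_gt0// mul1r.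
have [d2|d2] := leqP d 2.
  have : d%:R <= 2 :> R by rewrite ler_nat.
  by move=> /(ler_wpM2l (ltW alpha0)); lra.
have dm2 : (2 < d + m)%N by rewrite (leq_trans d2)// leq_addr.
move: alpha_lt; rewrite /upper_critical leqNgt dm2 /= lte_fin.
rewrite ltr_pdivlMr ?ltr0n ?subn_gt0// natrB ?(ltnW dm2)// natrD.
have : 0 <= m%:R :> R by rewrite ler0n.
by move=> /(mulr_ge0 (ltW alpha0)); lra.
Qed.

Theorem proposition1p2 (R : realType) (d m : nat) (alpha omega : R)
    (hd : (1 <= d)%N) (hm : m = 0%N \/ m = 1%N)
    (halpha_ge : lower_critical R d <= alpha)
    (halpha_lt : (alpha%:E < upper_critical R d m)%E)
    (homega : 0 < omega) :
  gamma_inf d m alpha omega = beta_inf d m alpha omega.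
Proof.
have d0 : 0 < d%:R :> R by rewrite ltr0n.
have alpha0 : 0 < alpha by apply: lt_le_trans halpha_ge; rewrite divr_gt0.
apply: gamma_inf_eq_beta_inf => //.
- by rewrite -ler_pdivrMr.
- exact: subcritical_exponent halpha_lt.
Qed.
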